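(* Let $K\colon\mathcal{P}\to\mathcal{Z}$ be the strict symmetric monoidal functor from the free permutative category on an invertible generator to the super integers that is determined, via the universal property of $\mathcal{P}$, by the canonical invertible pair $\underline{1}=(1,-1,\mathrm{id},\mathrm{id})$ in $\mathcal{Z}$; that is, $K(x)=1$, $K(y)=-1$, $K(\eta)=\mathrm{id}_0$, $K(\varepsilon)=\mathrm{id}_0$. Then $K$ is a symmetric monoidal equivalence.
   Context: A permutative category $(A,+,0,\beta)$ is a strict monoidal category $(A,+,0)$ with a natural isomorphism $\beta_{x,y}\colon x+y\to y+x$ such that $\beta_{y,x}\beta_{x,y}=\mathrm{id}$ and $\beta_{x,y+z}=(\mathrm{id}_y+\beta_{x,z})\circ(\beta_{x,y}+\mathrm{id}_z)$. A symmetric monoidal functor $F\colon A\to B$ is a functor with a natural isomorphism $F_{2;x,y}\colon Fx+Fy\to F(x+y)$ and an isomorphism $F_0\colon 0\to F0$ satisfying the usual associativity, unit and symmetry axioms; it is strict if $F_2$ and $F_0$ are identities. A monoidal transformation $\phi\colon F\Rightarrow G$ is a natural transformation with $\phi_{x+y}F_{2;x,y}=G_{2;x,y}(\phi_x+\phi_y)$ and $\phi_0F_0=G_0$. A symmetric monoidal equivalence is an equivalence in the 2-category of permutative categories, symmetric monoidal functors and monoidal transformations (i.e. a symmetric monoidal functor with a symmetric monoidal inverse up to monoidal natural isomorphism). $\mathsf{PermCat}_s$ denotes the 2-category of permutative categories, strict symmetric monoidal functors and monoidal transformations; $\mathbb{S}C$ denotes the free permutative category on a small category $C$. An invertible pair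 in $A$ is a tuple $(a,a',\eta,\varepsilon)$ with objects $a,a'$ and isomorphisms $\eta\colon 0\to a'+a$, $\varepsilon\colon a+a'\to 0$ such that $(\varepsilon+\mathrm{id}_a)\circ(\mathrm{id}_a+\eta)=\mathrm{id}_a$ and $(\mathrm{id}_{a'}+\varepsilon)\circ(\eta+\mathrm{id}_{a'})=\mathrm{id}_{a'}$. The free permutative category $\mathcal{P}$ on an invertible generator $x$ is built by successive pushouts in $\mathsf{PermCat}_s$. Write $\{a,b\}$, $\{a\cong b\}$, $\{a\to b\}$, $\{a\rightrightarrows b\}$ for the categories with two objects $a,b$ and, respectively, no non-identity morphisms, one isomorphism between $a$ and $b$, one non-identity morphism $a\to b$, two distinct non-identity morphisms $a\to b$; let $p\colon\{a,b\}\to\{a\cong b\}$ and $q\colon\{a\rightrightarrows b\}\to\{a\to b\}$ be the identity-on-objects functors. (1) $\mathcal{S}_1$ is the pushout of $\mathbb{S}p$ along $\mathbb{S}\{a,b\}\to\mathbb{S}\{x,y\}$, $a\mapsto x+y$, $b\mapsto 0$; the image of $a\cong b$ is called $\varepsilon\colon x+y\cong 0$. (2) $\mathcal{S}_2$ is the pushout of $\mathbb{S}p$ along $\mathbb{S}\{a,b\}\to\mathcal{S}_1$, $a\mapsto 0$, $b\mapsto y+x$; the image of $a\cong b$ is called $\eta\colon 0\cong y+x$. (3) $\mathcal{S}_3$ is the pushout of $\mathbb{S}q$ along $\mathbb{S}\{a\rightrightarrows b\}\to\mathcal{S}_2$ sending the two arrows to $(\varepsilon+x)\circ(x+\eta)$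 and $\mathrm{id}_x$. (4) $\mathcal{P}$ is the pushout of $\mathbb{S}q$ along $\mathbb{S}\{a\rightrightarrows b\}\to\mathcal{S}_3$ sending the two arrows to $(y+\varepsilon)\circ(\eta+y)$ and $\mathrm{id}_y$. Thus $(x,y,\eta,\varepsilon)$ is an invertible pair in $\mathcal{P}$, and strict symmetric monoidal functors $\mathcal{P}\to A$ correspond bijectively to invertible pairs in $A$ (the images of $(x,y,\eta,\varepsilon)$). The super integers $\mathcal{Z}$: the permutative category with objects the integers, $\mathcal{Z}(k,j)=\emptyset$ if $k\ne j$, $\mathcal{Z}(k,k)=\{1_k,-1_k\}$ with composition given by multiplication in $\{\pm1\}$; monoidal sum given by addition of integers on objects and $\mu_k+\nu_j=(\mu\nu)_{k+j}$ on morphisms; unit $0$; symmetry $\beta_{k,j}=((-1)^{jk})_{k+j}$. *)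

(* Defs.v *)
From Stdlib Require Import Eqdep.
From mathcomp Require Import all_boot all_algebra.

Set Implicit Arguments.
Unset Strict Implicit.
Unset Printing Implicit Defensive.

Declare Scope perm_scope.
Delimit Scope perm_scope with perm.

Record category := Category {
  ob :> Type;
  hom : ob -> ob -> Type;
  idm : forall a, hom a a;
  comp : forall a b c, hom b c -> hom a b -> hom a c;
  comp1m : forall a b (f : hom a b), comp (idm b) f = f;
  compm1 : forall a b (f : hom a b), comp f (idm a) = f;
  compA : forall a b c d (f : hom a b) (g : hom b c) (h : hom c d),
    comp h (comp g f) = comp (comp h g) f
}.
Arguments idm {c} a : rename.

Notation "g \o f" := (comp g f) : perm_scope.
Local Open Scope perm_scope.
#[local] Obligation Tactic := idtac.

(* Equality of morphisms whose sources and targets are only propositionally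
   equal: [heq f g] says that the sources agree, the targets agree, and, along
   these equalities, the morphisms agree. *)
Inductive heq (C : category) (a b : C) (f : hom a b) :
  forall c d : C, hom c d -> Prop := HEq : heq f f.

(* The identity morphism of [a], seen as a morphism to an equal object. *)
Definition idto (C : category) (a b : C) (e : a = b) : hom a b :=
  match e in _ = c return hom a c with erefl => idm a end.

Definition is_iso (C : category) (a b : C) (f : hom a b) : Prop :=
  exists g : hom b a, g \o f = idm a /\ f \o g = idm b.

Record functor (C D : category) := Functor {
  fob :> C -> D;
  fmap : forall a b, hom a b -> hom (fob a) (fob b);
  fmap1 : forall a, fmap (idm a) = idm (fob a);
  fmapM : forall a b c (f : hom a b) (g : hom b c),
    fmap (g \o f) = fmap g \o fmap f
}.
Arguments fmap {C D} f0 {a b} _ : rename.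

(* Equality of functors, on objects and on morphisms. *)
Definition feq (C D : category) (F G : functor C D) : Prop :=
  forall (a b : C) (f : hom a b), heq (fmap F f) (fmap G f).

Program Definition fid (C : category) : functor C C :=
  {| fob := fun a => a; fmap := fun a b f => f |}.
Next Obligation. by []. Qed.
Next Obligation. by []. Qed.

Program Definition fcomp (C D E : category) (G : functor D E)
    (F : functor C D) : functor C E :=
  {| fob := fun a => G (F a); fmap := fun a b f => fmap G (fmap F f) |}.
Next Obligation. move=> * /=; by rewrite !fmap1. Qed.
Next Obligation. move=> * /=; by rewrite !fmapM. Qed.

Record permcat := PermCat {
  pcat :> category;
  padd : pcat -> pcat -> pcat;
  pzero : pcat;
  paddm : forall a b c d : pcat,
    hom a b -> hom c d -> hom (padd a c) (padd b d);
  paddm1 : forall a b : pcat, paddm (idm a) (idm b) = idm (padd a b);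
  paddmM : forall (a b c a' b' c' : pcat) (f : hom a b) (g : hom b c)
      (f' : hom a' b') (g' : hom b' c'),
    paddm (g \o f) (g' \o f') = paddm g g' \o paddm f f';
  paddA : forall a b c : pcat, padd a (padd b c) = padd (padd a b) c;
  padd0 : forall a : pcat, padd a pzero = a;
  p0add : forall a : pcat, padd pzero a = a;
  paddmA : forall (a b c a' b' c' : pcat)
      (f : hom a a') (g : hom b b') (h : hom c c'),
    heq (paddm f (paddm g h)) (paddm (paddm f g) h);
  paddm0 : forall (a b : pcat) (f : hom a b), heq (paddm f (idm pzero)) f;
  p0addm : forall (a b : pcat) (f : hom a b), heq (paddm (idm pzero) f) f;
  pbeta : forall a b : pcat, hom (padd a b) (padd b a);
  pbeta_nat : forall (a b a' b' : pcat) (f : hom a a') (g : hom b b'),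
    pbeta a' b' \o paddm f g = paddm g f \o pbeta a b;
  pbetaK : forall a b : pcat, pbeta b a \o pbeta a b = idm (padd a b);
  pbeta_hex : forall a b c : pcat,
    heq (pbeta a (padd b c))
        (paddm (idm b) (pbeta a c)
           \o idto (esym (paddA b a c)) \o paddm (pbeta a b) (idm c))
}.
Arguments pzero {p} : rename.
Arguments pbeta {p} a b : rename.

Notation "x + y" := (padd x y) : perm_scope.
Notation "f \+ g" := (paddm f g) : perm_scope.

Record smfunctor (A B : permcat) := SMFunctor {
  smf :> functor A B;
  sm2 : forall x y : A, hom (smf x + smf y) (smf (x + y));
  sm0 : hom pzero (smf pzero);
  sm2_iso : forall x y, is_iso (sm2 x y);
  sm0_iso : is_iso sm0;
  sm2_nat : forall (x y x' y' : A) (f : hom x x') (g : hom y y'),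
    fmap smf (f \+ g) \o sm2 x y = sm2 x' y' \o (fmap smf f \+ fmap smf g);
  sm2A : forall x y z : A,
    heq (sm2 x (y + z) \o (idm (smf x) \+ sm2 y z))
        (sm2 (x + y) z \o (sm2 x y \+ idm (smf z)));
  sm2_0l : forall x : A,
    heq (sm2 pzero x \o (sm0 \+ idm (smf x))) (idm (smf x));
  sm2_0r : forall x : A,
    heq (sm2 x pzero \o (idm (smf x) \+ sm0)) (idm (smf x));
  sm2_beta : forall x y : A,
    fmap smf (pbeta x y) \o sm2 x y = sm2 y x \o pbeta (smf x) (smf y)
}.
Arguments sm2 {A B} s x y : rename.
Arguments sm0 {A B} s : rename.

Definition is_strict (A B : permcat) (F : smfunctor A B) : Prop :=
  (forall x y : A, heq (sm2 F x y) (idm (F x + F y))) /\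
  heq (sm0 F) (idm (@pzero B)).

Record strictfunctor (A B : permcat) := StrictFunctor {
  strict_sm :> smfunctor A B;
  strictP : is_strict strict_sm
}.

Record montransf (A B : permcat) (F G : smfunctor A B) := MonTransf {
  mt :> forall x : A, hom (F x) (G x);
  mt_nat : forall (x y : A) (f : hom x y),
    mt y \o fmap F f = fmap G f \o mt x;
  mt_2 : forall x y : A, mt (x + y) \o sm2 F x y = sm2 G x y \o (mt x \+ mt y);
  mt_0 : mt pzero \o sm0 F = sm0 G
}.

Definition moniso (A B : permcat) (F G : smfunctor A B) : Prop :=
  exists phi : montransf F G, forall x : A, is_iso (phi x).

Section HeqTheory.
Variable C : category.

Lemma heq_eq (a b : C) (f g : hom a b) : heq f g -> f = g.
Proof.
have H (c d : C) (h : hom c d) : heq f h -> exists (e1 : a = c) (e2 : b = d),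
    eq_rect b (hom c) (eq_rect a (fun x => hom x b) f c e1) d e2 = h.
  by case; exists erefl, erefl.
move/H => [e1 [e2 <-]].
by rewrite (EqdepTheory.UIP_refl _ _ e1) (EqdepTheory.UIP_refl _ _ e2).
Qed.

Lemma heq_sym (a b c d : C) (f : hom a b) (g : hom c d) : heq f g -> heq g f.
Proof. by case. Qed.

Lemma heq_trans (a b c d x y : C) (f : hom a b) (g : hom c d) (h : hom x y) :
  heq f g -> heq g h -> heq f h.
Proof. by case. Qed.

Lemma eq_heq (a b : C) (f g : hom a b) : f = g -> heq f g.
Proof. by move->. Qed.

Lemma heq_ob (a b c d : C) (f : hom a b) (g : hom c d) :
  heq f g -> a = c /\ b = d.
Proof. by case. Qed.

Lemma heq_comp (a b c a' b' c' : C) (f : hom a b) (g : hom b c)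
    (f' : hom a' b') (g' : hom b' c') :
  heq f f' -> heq g g' -> heq (g \o f) (g' \o f').
Proof.
move=> Hf; case: a' b' f' / Hf g' => g' Hg.
have [_ e] := heq_ob Hg; case: c' / e g' Hg => g' Hg.
by rewrite (heq_eq Hg).
Qed.

Lemma heq_idto (a b : C) (e : a = b) : heq (idto e) (idm a).
Proof. by case: b / e. Qed.

Lemma is_iso1 (a : C) : is_iso (idm a).
Proof. by exists (idm a); rewrite comp1m. Qed.

Lemma is_isoM (a b c : C) (f : hom a b) (g : hom b c) :
  is_iso f -> is_iso g -> is_iso (g \o f).
Proof.
move=> [f' [f1 f2]] [g' [g1 g2]]; exists (f' \o g'); split.
  by rewrite -compA (compA f g) g1 comp1m.
by rewrite -compA (compA g' f') f2 comp1m.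
Qed.

End HeqTheory.

Lemma heq_fmap (C D : category) (F : functor C D) (a b c d : C)
    (f : hom a b) (g : hom c d) : heq f g -> heq (fmap F f) (fmap F g).
Proof. by case. Qed.

Lemma is_iso_fmap (C D : category) (F : functor C D) (a b : C) (f : hom a b) :
  is_iso f -> is_iso (fmap F f).
Proof. by move=> [g [h1 h2]]; exists (fmap F g); rewrite -!fmapM h1 h2 !fmap1. Qed.

Program Definition smid (A : permcat) : smfunctor A A :=
  {| smf := fid A; sm2 := fun x y => idm (x + y); sm0 := idm pzero |}.
Next Obligation. move=> * /=; exact: is_iso1. Qed.
Next Obligation. move=> * /=; exact: is_iso1. Qed.
Next Obligation. move=> * /=; by rewrite comp1m compm1. Qed.
Next Obligation.
move=> * /=.
rewrite !comp1m !paddm1 paddA; exact: HEq.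
Qed.
Next Obligation. move=> * /=; rewrite comp1m; exact: p0addm. Qed.
Next Obligation. move=> * /=; rewrite comp1m; exact: paddm0. Qed.
Next Obligation. move=> * /=; by rewrite comp1m compm1. Qed.

Program Definition smcomp (A B C : permcat) (G : smfunctor B C)
    (F : smfunctor A B) : smfunctor A C :=
  {| smf := fcomp G F;
     sm2 := fun x y => fmap G (sm2 F x y) \o sm2 G (F x) (F y);
     sm0 := fmap G (sm0 F) \o sm0 G |}.
Next Obligation.
move=> * /=.
apply: is_isoM; [exact: sm2_iso | apply: is_iso_fmap; exact: sm2_iso].
Qed.
Next Obligation.
move=> * /=.
apply: is_isoM; [exact: sm0_iso | apply: is_iso_fmap; exact: sm0_iso].
Qed.
Next Obligation. move=> * /=; by rewrite compA -fmapM sm2_nat fmapM -!compA sm2_nat. Qed.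
Next Obligation.
move=> A B C G F x y z /=.
rewrite -[idm (G (F x))](comp1m (idm _)) -[idm (G (F z))](comp1m (idm _)).
rewrite !paddmM -!fmap1 -!compA !(compA _ _ (sm2 G _ _)) -!sm2_nat.
rewrite -!compA !(compA _ (fmap G (_ \+ _)) _) -!fmapM !fmap1.
apply: heq_comp; first exact: sm2A.
by apply: heq_fmap; apply: sm2A.
Qed.
Next Obligation.
move=> A B C G F x /=.
rewrite -[idm (G (F x))](comp1m (idm _)) paddmM -!fmap1 -!compA.
rewrite (compA _ _ (sm2 G _ _)) -sm2_nat -!compA (compA _ (fmap G (_ \+ _)) _).
rewrite -fmapM !fmap1.
apply: (heq_trans (heq_comp (sm2_0l G (F x)) (heq_fmap G (sm2_0l F x)))).
by rewrite fmap1 comp1m; apply: HEq.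
Qed.
Next Obligation.
move=> A B C G F x /=.
rewrite -[idm (G (F x))](comp1m (idm _)) paddmM -!fmap1 -!compA.
rewrite (compA _ _ (sm2 G _ _)) -sm2_nat -!compA (compA _ (fmap G (_ \+ _)) _).
rewrite -fmapM !fmap1.
apply: (heq_trans (heq_comp (sm2_0r G (F x)) (heq_fmap G (sm2_0r F x)))).
by rewrite fmap1 comp1m; apply: HEq.
Qed.
Next Obligation.
move=> * /=.
by rewrite compA -fmapM sm2_beta fmapM -!compA sm2_beta.
Qed.

Definition sm_equivalence (A B : permcat) (F : smfunctor A B) : Prop :=
  exists G : smfunctor B A,
    moniso (smcomp G F) (smid A) /\ moniso (smcomp F G) (smid B).

(* Tuples (a, a', eta, eps), not yet required to be invertible pairs. *)
Record pairdata (A : permcat) := PairData {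
  pd_l : A;
  pd_r : A;
  pd_eta : hom pzero (pd_r + pd_l);
  pd_eps : hom (pd_l + pd_r) pzero
}.

Section Zigzag.
Variables (A : permcat) (d : pairdata A).
Local Notation a := (pd_l d).
Local Notation a' := (pd_r d).

(* (eps + a) o (a + eta), as a morphism a -> a *)
Definition zigl : hom a a :=
  idto (p0add a) \o (pd_eps d \+ idm a) \o idto (paddA a a' a)
    \o (idm a \+ pd_eta d) \o idto (esym (padd0 a)).

(* (a' + eps) o (eta + a'), as a morphism a' -> a' *)
Definition zigr : hom a' a' :=
  idto (padd0 a') \o (idm a' \+ pd_eps d) \o idto (esym (paddA a' a a'))
    \o (pd_eta d \+ idm a') \o idto (esym (p0add a')).

Definition is_invertible_pair : Prop :=
  [/\ is_iso (pd_eta d), is_iso (pd_eps d), zigl = idm a & zigr = idm a'].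

End Zigzag.

Record invpair (A : permcat) := InvPair {
  ip_data :> pairdata A;
  ipP : is_invertible_pair ip_data
}.

(* For strict [F]: the image of the tuple [d] under [F] is [e]. *)
Definition maps_pair (A B : permcat) (F : strictfunctor A B)
    (d : pairdata A) (e : pairdata B) : Prop :=
  [/\ F (pd_l d) = pd_l e, F (pd_r d) = pd_r e,
      heq (fmap F (pd_eta d)) (pd_eta e) & heq (fmap F (pd_eps d)) (pd_eps e)].

Record freeperm (C : category) := FreePerm {
  fp :> permcat;
  fp_in : functor C fp;
  fp_lift : forall A : permcat, functor C A -> strictfunctor fp A;
  fp_liftE : forall (A : permcat) (F : functor C A),
    feq (fcomp (fp_lift F) fp_in) F;
  fp_lift_uniq : forall (A : permcat) (F : functor C A)
      (G : strictfunctor fp A),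
    feq (fcomp G fp_in) F -> feq G (fp_lift F)
}.
Arguments fp_in {C} f : rename.
Arguments fp_lift {C} f {A} F : rename.

Definition free_map (S : forall C, freeperm C) (C D : category)
    (F : functor C D) : strictfunctor (S C) (S D) :=
  fp_lift (S C) (fcomp (fp_in (S D)) F).

(* D, with legs h and k, is a pushout of f and g:
       A --f--> B
       |g       |h
       C --k--> D   *)
Definition is_pushout (A B C D : permcat) (f : strictfunctor A B)
    (g : strictfunctor A C) (h : strictfunctor B D) (k : strictfunctor C D) :
    Prop :=
  feq (fcomp h f) (fcomp k g) /\
  forall (E : permcat) (u : strictfunctor B E) (v : strictfunctor C E),
    feq (fcomp u f) (fcomp v g) ->
    exists2 w : strictfunctor D E,
      feq (fcomp w h) u /\ feq (fcomp w k) v &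
      forall w' : strictfunctor D E,
        feq (fcomp w' h) u -> feq (fcomp w' k) v -> feq w' w.

Inductive two := pa | pb.

(* A category with two objects whose only non-identity morphisms go from [pa]
   to [pb], these being indexed by [T]. *)
Section TwoCat.
Variable T : Type.

Definition arr_hom (s t : two) : Type :=
  match s, t with
  | pa, pb => T
  | pb, pa => Empty_set
  | _, _ => unit
  end.

Definition arr_comp (s t u : two) : arr_hom t u -> arr_hom s t -> arr_hom s u :=
  match s, t, u with
  | pa, pa, pa | pb, pb, pb => fun _ _ => tt
  | pa, pa, pb => fun g _ => g
  | pa, pb, pb => fun _ f => f
  | pa, pb, pa => fun g _ => match g with end
  | pb, pa, _ => fun _ f => match f with end
  | pb, pb, pa => fun g _ => match g with end
  end.

Program Definition arrcat : category :=
  {| ob := two; hom := arr_hom;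
     idm := fun s => match s with pa => tt | pb => tt end; comp := arr_comp |}.
Next Obligation. by move=> [] [] // []. Qed.
Next Obligation. by move=> [] [] // []. Qed.
Next Obligation. by move=> [] [] [] []. Qed.

Variables (C : category) (u v : C) (m : T -> hom u v).

Definition arr_ob (s : two) : C := if s is pa then u else v.

Definition arr_map (s t : two) : arr_hom s t -> hom (arr_ob s) (arr_ob t) :=
  match s, t return arr_hom s t -> hom (arr_ob s) (arr_ob t) with
  | pa, pa => fun=> idm u
  | pa, pb => m
  | pb, pa => fun f => match f with end
  | pb, pb => fun=> idm v
  end.

Program Definition arrfun : functor arrcat C :=
  {| fob := arr_ob; fmap := arr_map |}.
Next Obligation. by move=> []. Qed.
Next Obligation.
by move=> [] [] [] //= f g; rewrite ?comp1m ?compm1.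
Qed.

End TwoCat.

(* {a, b}, {a -> b}, {a => b} and {a ~= b} *)
Definition disccat : category := arrcat Empty_set.
Definition singlecat : category := arrcat unit.
Definition parcat : category := arrcat bool.
Program Definition isocat : category :=
  {| ob := two; hom := fun _ _ => unit; idm := fun=> tt;
     comp := fun _ _ _ _ _ => tt |}.
Next Obligation. by move=> ? ? []. Qed.
Next Obligation. by move=> ? ? []. Qed.
Next Obligation. by []. Qed.

Definition discfun (C : category) (u v : C) : functor disccat C :=
  arrfun (fun e : Empty_set => match e return hom u v with end).

Definition parfun (C : category) (u v : C) (f g : hom u v) : functor parcat C :=
  arrfun (fun b : bool => if b then f else g).

Definition pfun : functor disccat isocat := @discfun isocat pa pb.
Definition qfun : functor parcat singlecat := @parfun singlecat pa pb tt tt.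

Record free_invertible (S : forall C, freeperm C) := FreeInvertible {
  (* {x, y} is [disccat], with x = [pa] and y = [pb] *)
  fi_S1 : permcat;
  fi_j1 : strictfunctor (S disccat) fi_S1;
  fi_k1 : strictfunctor (S isocat) fi_S1;
  fi_po1 : is_pushout (free_map S pfun)
    (fp_lift (S disccat)
      (discfun (fp_in (S disccat) pa + fp_in (S disccat) pb) pzero))
    fi_k1 fi_j1;
  fi_eps1 : hom (fi_j1 (fp_in (S disccat) pa) + fi_j1 (fp_in (S disccat) pb))
                pzero;
  fi_eps1E :
    heq (fmap fi_k1 (fmap (fp_in (S isocat)) (tt : @hom isocat pa pb))) fi_eps1;
  (* [fi_gen2] is (x, y, eta, eps) in S_2; the fields below determine it *)
  fi_S2 : permcat;
  fi_j2 : strictfunctor fi_S1 fi_S2;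
  fi_k2 : strictfunctor (S isocat) fi_S2;
  fi_po2 : is_pushout (free_map S pfun)
    (fp_lift (S disccat)
      (discfun pzero (fi_j1 (fp_in (S disccat) pb)
                        + fi_j1 (fp_in (S disccat) pa))))
    fi_k2 fi_j2;
  fi_gen2 : pairdata fi_S2;
  fi_gen2_l : fi_j2 (fi_j1 (fp_in (S disccat) pa)) = pd_l fi_gen2;
  fi_gen2_r : fi_j2 (fi_j1 (fp_in (S disccat) pb)) = pd_r fi_gen2;
  fi_gen2_eps : heq (fmap fi_j2 fi_eps1) (pd_eps fi_gen2);
  fi_gen2_eta :
    heq (fmap fi_k2 (fmap (fp_in (S isocat)) (tt : @hom isocat pa pb)))
        (pd_eta fi_gen2);
  fi_S3 : permcat;
  fi_j3 : strictfunctor fi_S2 fi_S3;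
  fi_k3 : strictfunctor (S singlecat) fi_S3;
  fi_po3 : is_pushout (free_map S qfun)
    (fp_lift (S parcat) (parfun (zigl fi_gen2) (idm (pd_l fi_gen2))))
    fi_k3 fi_j3;
  fi_gen3 : pairdata fi_S3;
  fi_gen3E : maps_pair fi_j3 fi_gen2 fi_gen3;
  fi_P :> permcat;
  fi_j4 : strictfunctor fi_S3 fi_P;
  fi_k4 : strictfunctor (S singlecat) fi_P;
  fi_po4 : is_pushout (free_map S qfun)
    (fp_lift (S parcat) (parfun (zigr fi_gen3) (idm (pd_r fi_gen3))))
    fi_k4 fi_j4;
  fi_gen : pairdata fi_P;
  fi_genE : maps_pair fi_j4 fi_gen3 fi_gen
}.

Section SuperIntegers.
Import GRing.Theory Num.Theory.
Local Open Scope ring_scope.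

Definition is_sign (s : int) : bool := (s == 1) || (s == -1).

Definition super_hom (k j : int) : Type := {s : int | is_sign s && (k == j)}.

Lemma is_signM (s t : int) : is_sign s -> is_sign t -> is_sign (s * t).
Proof. by case/orP=> /eqP-> /orP[] /eqP->. Qed.

Lemma is_signX (n : int) : is_sign ((-1) ^ n).
Proof.
by rewrite /is_sign expN1r -signr_odd; case: (odd _); rewrite ?expr0 ?expr1 eqxx ?orbT.
Qed.

Lemma is_sign_sqr (s : int) : is_sign s -> s * s = 1.
Proof. by case/orP=> /eqP->. Qed.

Lemma super_subproof (k j : int) (s : int) :
  is_sign s -> k = j -> is_sign s && (k == j).
Proof. by move=> -> ->; rewrite eqxx. Qed.

Definition SuperHom (k j s : int) (hs : is_sign s) (e : k = j) : super_hom k j :=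
  exist _ s (super_subproof hs e).

Lemma super_sign (k j : int) (f : super_hom k j) : is_sign (val f).
Proof. by case/andP: (valP f). Qed.

Lemma super_eq (k j : int) (f : super_hom k j) : k = j.
Proof. by case/andP: (valP f) => _ /eqP. Qed.

Program Definition supercat : category :=
  {| ob := int;
     hom := super_hom;
     idm := fun k => SuperHom (s := 1) isT erefl;
     comp := fun k j l g f =>
       SuperHom (is_signM (super_sign g) (super_sign f))
                (etrans (super_eq f) (super_eq g)) |}.
Next Obligation. move=> * /=; by apply: val_inj => /=; rewrite mul1r. Qed.
Next Obligation. move=> * /=; by apply: val_inj => /=; rewrite mulr1. Qed.
Next Obligation. move=> * /=; by apply: val_inj => /=; rewrite mulrA. Qed.

Lemma super_heq (k j k' j' : int) (f : @hom supercat k j)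
    (g : @hom supercat k' j') : k = k' -> val f = val g -> heq f g.
Proof.
have ef := super_eq f; have eg := super_eq g.
case: j / ef f => f; case: j' / eg g => g e.
case: k' / e g => g /val_inj ->; exact: HEq.
Qed.

Lemma val_idto (k j : supercat) (e : k = j) : val (idto e) = 1.
Proof. by case: j / e. Qed.

Lemma super_betaK (j k : int) : (-1 : int) ^ (j * k) * (-1) ^ (k * j) = 1.
Proof. by rewrite (mulrC j) is_sign_sqr // is_signX. Qed.

Program Definition superint : permcat :=
  {| pcat := supercat;
     padd := fun k j => k + j : int;
     pzero := 0 : int;
     paddm := fun k k' j j' (f : super_hom k k') (g : super_hom j j') =>
       SuperHom (is_signM (super_sign f) (super_sign g))
                (f_equal2 +%R (super_eq f) (super_eq g));
     pbeta := fun k j => SuperHom (is_signX (j * k)) (addrC k j) |}.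
Next Obligation. move=> *; exact: val_inj. Qed.
Next Obligation. move=> *; by apply: val_inj => /=; rewrite mulrACA. Qed.
Next Obligation. move=> *; exact: addrA. Qed.
Next Obligation. move=> *; exact: addr0. Qed.
Next Obligation. move=> *; exact: add0r. Qed.
Next Obligation. move=> *; by apply: super_heq; rewrite /= ?addrA ?mulrA. Qed.
Next Obligation. move=> *; by apply: super_heq; rewrite /= ?addr0 ?mulr1. Qed.
Next Obligation. move=> *; by apply: super_heq; rewrite /= ?add0r ?mul1r. Qed.
Next Obligation.
move=> k j k' j' f g; apply: val_inj => /=.
rewrite mulrC (mulrC (sval f)); congr (_ * (-1) ^ (_ * _)).
  exact: esym (super_eq g).
exact: esym (super_eq f).
Qed.
Next Obligation. move=> *; by apply: val_inj => /=; rewrite super_betaK. Qed.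
Next Obligation.
move=> k j l; apply: super_heq => /=; first by rewrite addrA.
by rewrite val_idto mulr1 mul1r mulr1 mulrDl exprzDr // mulrC.
Qed.

Definition super_one_data : pairdata superint :=
  @PairData superint (1 : int) (-1 : int)
    (@idto supercat 0 (-1 + 1) (esym (addNr 1)))
    (@idto supercat (1 - 1) 0 (addrN 1)).

Lemma super_one_invertible : is_invertible_pair super_one_data.
Proof.
have idtoI (k j : supercat) (e : k = j) : is_iso (idto e).
  by case: j / e; apply: is_iso1.
split; try exact: idtoI.
all: by apply: val_inj; rewrite /= !val_idto.
Qed.

Definition super_one : invpair superint := InvPair super_one_invertible.

End SuperIntegers.

(* Main.v *)
(** Every object of [P] is a word in [x] and [y], and cancelling the letters [y]
    with [eta] gives each word [w] an isomorphism [phi w] from [w + x^b] to [x^a],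
    where [a] and [b] count the letters [x] and [y] of [w].  The symmetry of
    [x + x] is the identity up to an involution [t] of the unit object, hence so
    are all symmetries between powers of [x].  Call a morphism stable if, after
    adding a power of [x], it commutes with the maps [phi] up to [t].  Stable
    morphisms are closed under all operations and contain [eta] and [eps]: they
    form a sub-permutative category, which is all of [P] by the universal
    property.  As [x] can be cancelled, two parallel morphisms of [P] are equal or
    differ by [t], and [K t = -1] separates the two cases.  So [K] is faithful; it
    is full because [phi] and [t] provide the required morphisms, and a
    quasi-inverse is defined by lifting morphisms of [superint] along [K]. *)
From Stdlib Require Import ClassicalEpsilon Eqdep ProofIrrelevance.
From mathcomp Require Import all_boot all_algebra zify.
Require Import Defs.

Set Implicit Arguments.
Unset Strict Implicit.
Unset Printing Implicit Defensive.

Local Open Scope perm_scope.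
#[local] Obligation Tactic := idtac.

(* Equality of total morphisms is [heq] ([heqP]); on them, associativity of the
   sum is a Leibniz equation, at the price of a partial composition. *)
Record arr (C : category) := Arr { dom : C; cod : C; mor : hom dom cod }.
Arguments Arr {C dom cod} mor : rename.

(** * Composition and inverses of total morphisms *)

Section Arrows.
Variable C : category.
Implicit Types f g h : arr C.

Lemma heqP (a b c d : C) (f : hom a b) (g : hom c d) :
  heq f g <-> Arr f = Arr g.
Proof.
split=> [|e]; first by case.
have H (u v : arr C) : u = v -> heq (mor u) (mor v) by move=> ->; apply: HEq.
exact: (H _ _ e).
Qed.

Definition aid (a : C) : arr C := Arr (idm a).

(* The junk value [g] for non-composable arguments makes [cod_comp]
   unconditional. *)
Definition acomp g f : arr C :=
  if excluded_middle_informative (cod f = dom g) is left e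
  then Arr (mor g \o ecast b (hom (dom f) b) e (mor f)) else g.

Lemma acompE (a b c : C) (f : hom a b) (g : hom b c) :
  acomp (Arr g) (Arr f) = Arr (g \o f).
Proof.
rewrite /acomp; case: excluded_middle_informative => //= e.
by rewrite (EqdepTheory.UIP_refl _ _ e).
Qed.

Lemma cod_comp g f : cod (acomp g f) = cod g.
Proof. by rewrite /acomp; case: excluded_middle_informative. Qed.

Lemma dom_comp g f : cod f = dom g -> dom (acomp g f) = dom f.
Proof. by rewrite /acomp; case: excluded_middle_informative. Qed.

Lemma acompA f g h : cod f = dom g -> cod g = dom h ->
  acomp h (acomp g f) = acomp (acomp h g) f.
Proof.
case: f g h => [a b f] [b' c g] [c' d h] /= e e'.
by case: b' / e g => g; case: c' / e' h => h; rewrite !acompE compA.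
Qed.

Lemma acomp1m a f : cod f = a -> acomp (aid a) f = f.
Proof. by move=> <-; case: f => [c d f]; rewrite acompE comp1m. Qed.

Lemma acompm1 a f : dom f = a -> acomp f (aid a) = f.
Proof. by move=> <-; case: f => [c d f]; rewrite acompE compm1. Qed.

Definition ainv f g : Prop :=
  [/\ dom g = cod f, cod g = dom f, acomp g f = aid (dom f)
    & acomp f g = aid (cod f)].

Definition aiso f : Prop := exists g, ainv f g.

Lemma ainv_sym f g : ainv f g -> ainv g f.
Proof. by case=> e1 e2 e3 e4; split; rewrite ?e1 ?e2. Qed.

Lemma ainv_uniq f g h : ainv f g -> ainv f h -> g = h.
Proof.
case=> e1 e2 e3 e4 [e1' e2' e3' e4'].
rewrite -[LHS](@acompm1 (cod f)) // -e4' acompA; last by [].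
  by rewrite e3 acomp1m.
by [].
Qed.

Lemma aiso_id a : aiso (aid a).
Proof. by exists (aid a); split; rewrite ?acomp1m. Qed.

Lemma aiso_comp f g : cod f = dom g -> aiso f -> aiso g -> aiso (acomp g f).
Proof.
move=> e [f' [a1 a2 a3 a4]] [g' [b1 b2 b3 b4]]; exists (acomp f' g').
have e' : cod g' = dom f' by rewrite b2 a1.
have ec : cod (acomp g f) = dom g' by rewrite cod_comp b1.
split; rewrite ?cod_comp ?dom_comp //.
  by rewrite -acompA // (@acompA f g g') // b3 -e acomp1m.
rewrite -acompA ?cod_comp ?dom_comp //.
by rewrite (@acompA g' f' f) // a4 e acomp1m // b2.
Qed.

Lemma is_iso_arr (a b : C) (f : hom a b) : is_iso f <-> aiso (Arr f).
Proof.
split=> [[g [h1 h2]]|[[c d g] [/= e1 e2]]].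
  by exists (Arr g); split; rewrite // acompE (h1, h2).
subst c d; rewrite !acompE => /heqP/heq_eq h1 /heqP/heq_eq h2.
by exists g.
Qed.

End Arrows.

Lemma arr_idto (C : category) (a b : C) (e : a = b) : Arr (idto e) = aid a.
Proof. by case: b / e. Qed.

(* Sums and symmetries of total morphisms *)
Declare Scope arr_scope.
Delimit Scope arr_scope with arr.
Bind Scope arr_scope with arr.

Definition aadd (A : permcat) (f g : arr A) : arr A := Arr (mor f \+ mor g).
Definition bet (A : permcat) (a b : A) : arr A := Arr (pbeta a b).

Notation "f + g" := (aadd f g) : arr_scope.
Notation "g * f" := (acomp g f) : arr_scope.
Local Open Scope arr_scope.

Section PermArrows.
Variable A : permcat.
Implicit Types (f g h s : arr A) (a b c : A).

Lemma aaddA f g h : f + (g + h) = f + g + h.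
Proof. by case: f g h => ? ? f [? ? g] [? ? h]; apply/heqP; apply: paddmA. Qed.

Lemma aadd0 f : f + aid pzero = f.
Proof. by case: f => ? ? f; apply/heqP; apply: paddm0. Qed.

Lemma a0add f : aid pzero + f = f.
Proof. by case: f => ? ? f; apply/heqP; apply: p0addm. Qed.

Lemma aid_add a b : aid (a + b)%perm = aid a + aid b.
Proof. by rewrite /aid /aadd /= paddm1. Qed.

Lemma exch f g f' g' : cod f = dom g -> cod f' = dom g' ->
  (g + g') * (f + f') = g * f + g' * f'.
Proof.
case: f g f' g' => [a b f] [b' c g] [d e f'] [e' k g'] /= e1 e2.
case: b' / e1 g => g; case: e' / e2 g' => g'.
by rewrite /aadd /= !acompE /= paddmM.
Qed.

Lemma lcomp a f g : cod f = dom g ->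
  aid a + g * f = (aid a + g) * (aid a + f).
Proof. by move=> e; rewrite exch // acomp1m. Qed.

Lemma rcomp a f g : cod f = dom g ->
  g * f + aid a = (g + aid a) * (f + aid a).
Proof. by move=> e; rewrite exch // acomp1m. Qed.

Lemma split_l f g a b : cod g = a -> dom f = b ->
  f + g = (f + aid a) * (aid b + g).
Proof. by move=> ea eb; rewrite exch // acomp1m // acompm1. Qed.

Lemma split_r f g a b : dom g = a -> cod f = b ->
  f + g = (aid b + g) * (f + aid a).
Proof. by move=> ea eb; rewrite exch // acomp1m // acompm1. Qed.

Lemma aiso_add f g : aiso f -> aiso g -> aiso (f + g).
Proof.
move=> [f' [a1 a2 a3 a4]] [g' [b1 b2 b3 b4]]; exists (f' + g').
by split; rewrite /= ?a1 ?a2 ?b1 ?b2 // exch // (a3, a4) (b3, b4) aid_add.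
Qed.

Lemma bet_nat f g a b c d : dom f = a -> cod f = b -> dom g = c -> cod g = d ->
  bet b d * (f + g) = (g + f) * bet a c.
Proof.
move=> <- <- <- <-; case: f g => [? ? f] [? ? g] /=.
by rewrite /bet /aadd /= !acompE pbeta_nat.
Qed.

Lemma betK a b : bet b a * bet a b = aid a + aid b.
Proof. by rewrite /bet acompE pbetaK -aid_add. Qed.

(** The transport along associativity in [pbeta_hex] is an identity, hence disappears for total
    morphisms. *)
Lemma bet_hex a b c :
  bet a (b + c)%perm = (aid b + bet a c) * (bet a b + aid c).
Proof.
have /heqP h := pbeta_hex a b c; rewrite [LHS]h.
by rewrite -!acompE arr_idto acompm1 //= paddA.
Qed.

Lemma bet_inv a b : ainv (bet a b) (bet b a).
Proof. by split; rewrite ?betK -?aid_add. Qed.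

(** Both sides are inverse to [bet c (a + b)], which [bet_hex] decomposes. *)
Lemma bet_hexl a b c :
  bet (a + b)%perm c = (bet a c + aid b) * (aid a + bet b c).
Proof.
apply: ainv_uniq (bet_inv _ _) _; rewrite bet_hex.
split; rewrite ?cod_comp ?dom_comp //= ?paddA //.
  rewrite -acompA ?cod_comp ?dom_comp //= ?paddA //.
  rewrite (@acompA _ (bet c a + _)) //= ?paddA // -lcomp // betK.
  by rewrite -!aid_add acomp1m ?paddA // -rcomp // betK -!aid_add ?paddA.
rewrite -acompA ?cod_comp ?dom_comp //= ?paddA //.
rewrite (@acompA _ (aid a + _)) //= ?paddA // -rcomp // betK.
by rewrite -!aid_add acomp1m /= ?paddA // -lcomp // betK -!aid_add ?paddA.
Qed.

(** The hexagon at [pzero + pzero] shows that [bet a pzero] is idempotent; being invertible, it is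
    an identity. *)
Lemma bet0 a : bet a pzero = aid a.
Proof.
have e : bet a (pzero + pzero)%perm = bet a pzero by rewrite padd0.
rewrite bet_hex aadd0 a0add in e.
have /(congr1 (acomp (bet pzero a))) := e.
by rewrite acompA //= ?padd0 ?p0add // betK aadd0 acomp1m //= p0add.
Qed.

Lemma bet0l a : bet pzero a = aid a.
Proof.
by rewrite -[LHS](@acompm1 _ a) /= ?p0add // -[X in _ * X]bet0 betK aadd0.
Qed.

(** This is naturality of the symmetry, whose components at the unit object are identities. It lets
    signs slide through sums. *)
Lemma central s f : dom s = pzero -> cod s = pzero -> s + f = f + s.
Proof.
move=> e1 e2; have := @bet_nat s f _ _ _ _ e1 e2 erefl erefl.
by rewrite !bet0l acomp1m ?acompm1 //= ?e1 ?e2 ?p0add ?padd0.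
Qed.

End PermArrows.

Ltac solve_ob := rewrite /= ?cod_comp ?padd0 ?p0add ?paddA //=;
  try (rewrite dom_comp; solve_ob).

(** * Cancelling the object [x] of an invertible pair *)

Section InvertiblePair.
Variables (A : permcat) (d : invpair A).
Local Notation x := (pd_l d).
Local Notation y := (pd_r d).
Local Notation eta := (Arr (pd_eta d)).
Local Notation ep := (Arr (pd_eps d)).
Implicit Types (f g h s : arr A) (p q : A).

Lemma zig_left : (ep + aid x) * (aid x + eta) = aid x.
Proof.
have [_ _ /(congr1 Arr) e _] := ipP d.
rewrite -[RHS]e /zigl -!acompE !arr_idto acompm1; last by solve_ob.
by rewrite acomp1m ?acompm1; solve_ob.
Qed.

(** By the triangle identity [aid x + eta] is a right inverse of [ep + aid x], so it is the
    inverse. *)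
Lemma eps_inv_add epi : ainv ep epi -> epi + aid x = aid x + eta.
Proof.
move=> [/= e1 e2 e3 e4].
rewrite -[LHS](@acompm1 _ x) /= ?e1 ?p0add // -[X in _ * X]zig_left.
by rewrite acompA -?rcomp ?e3 -?aid_add ?acomp1m //= ?e1 ?e2; solve_ob.
Qed.

(* [g] is [f + y] conjugated by [eps]. *)
Lemma add_lift p q f : dom f = (p + x)%perm -> cod f = (q + x)%perm ->
  exists g, [/\ dom g = p, cod g = q & f = g + aid x].
Proof.
move=> ed ec; have [_ /is_iso_arr[epi ei] _ _] := ipP d.
have [/= e1 e2 e3 e4] := ei.
have c1 : cod (f + aid y) = dom (aid q + ep) by rewrite /= ec paddA.
have c2 : cod (aid p + epi) = dom (f + aid y) by rewrite /= ed e2 paddA.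
exists ((aid q + ep) * ((f + aid y) * (aid p + epi))); split.
- by rewrite !dom_comp ?cod_comp //= e1 padd0.
- by rewrite cod_comp /= padd0.
rewrite !rcomp ?cod_comp // -(aaddA _ epi) (eps_inv_add ei).
rewrite -(aaddA f) -aid_add aaddA exch ?acomp1m /= ?ed ?ec ?paddA //.
(* [f] and [eta] act on separate summands, so [eta] can be applied after [f]; there it meets [ep]
   and the triangle identity removes both. *)
rewrite -aid_add acompm1 // (@split_r _ f eta pzero (q + x)%perm) // aadd0.
rewrite acompA; solve_ob.
  by rewrite aid_add -!aaddA -lcomp ?zig_left -?aid_add ?acomp1m; solve_ob.
Qed.

(** Adding [y] and conjugating by [ep] recovers [f] from [f + aid x]. The endpoints are compared
    separately, as an equality of objects after adding [x] does not provide theirs. *)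
Lemma add_cancel f g : f + aid x = g + aid x -> dom f = dom g ->
  cod f = cod g -> f = g.
Proof.
have [_ /is_iso_arr[epi [/= e1 e2 e3 e4]] _ _] := ipP d.
have retr h : h = (aid (cod h) + ep) * ((h + aid x + aid y) * (aid (dom h) + epi)).
  by rewrite -(aaddA h) -aid_add acompA ?exch ?acomp1m ?acompm1 //= ?e4 ?aadd0 ?e2.
by move=> e ed ec; rewrite (retr f) (retr g) -e ed ec.
Qed.
End InvertiblePair.

(* [t] is [bet x x] descended twice along [- + x]. *)
Lemma bet_self (A : permcat) (d : invpair A) : exists t : hom (@pzero A) pzero,
  Arr t + Arr t = aid pzero /\
  bet (pd_l d) (pd_l d) = Arr t + aid (pd_l d + pd_l d)%perm.
Proof.
have [g [e1 e2 eg]] := @add_lift A d (pd_l d) (pd_l d) (bet _ _) erefl erefl.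
have [[a b t] [/= e3 e4 eh]] := @add_lift A d pzero pzero g
  (etrans e1 (esym (p0add _))) (etrans e2 (esym (p0add _))).
subst a b; rewrite eg eh -aaddA -aid_add; exists t; split=> //.
(* The symmetry of [x] with itself is an involution, so [t * t] becomes an identity after adding [x]
   twice. *)
have e : (Arr t * Arr t) + aid (pd_l d) + aid (pd_l d)
    = aid pzero + aid (pd_l d) + aid (pd_l d).
  by rewrite !rcomp // -eh -eg betK a0add.
(* Eckmann-Hilton: composition and sum agree on endomorphisms of the unit object. *)
have et : Arr t * Arr t = Arr t + Arr t.
  by rewrite (@split_l _ (Arr t) (Arr t) pzero pzero) // aadd0 a0add.
rewrite -et; apply: (@add_cancel A d); last by rewrite cod_comp.
  by apply: (@add_cancel A d); rewrite //= ?dom_comp ?cod_comp.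
by rewrite dom_comp.
Qed.

(** * Signs, powers of [x] and the symmetries between them *)

Section Stabilisation.
Variables (A : permcat) (d : invpair A) (t : hom (@pzero A) pzero).
Hypothesis tK : Arr t + Arr t = aid pzero.
Local Notation x := (pd_l d).
Local Notation y := (pd_r d).
Hypothesis bet_xx : bet x x = Arr t + aid (x + x)%perm.
Variable ieta : hom (y + x)%perm pzero.
Hypothesis ietaP : ainv (Arr (pd_eta d)) (Arr ieta).
Implicit Types (f g h s : arr A) (p q : A).

(** Signs act on morphisms through the sum. The two signs may coincide in [A]; in the free category
    it is [K] that tells them apart. *)
Definition is_sgn s : Prop := s = aid pzero \/ s = Arr t.

Lemma sgn0 : is_sgn (aid pzero). Proof. by left. Qed.

Lemma sgn_dom s : is_sgn s -> dom s = pzero. Proof. by case=> ->. Qed.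
Lemma sgn_cod s : is_sgn s -> cod s = pzero. Proof. by case=> ->. Qed.

Lemma sgnD s s' : is_sgn s -> is_sgn s' -> is_sgn (s + s').
Proof.
by rewrite /is_sgn; case=> -> [] ->; rewrite ?tK ?a0add ?aadd0; [left|right|right|left].
Qed.

Lemma sgnK s : is_sgn s -> s + s = aid pzero.
Proof. by case=> ->; rewrite ?tK ?a0add. Qed.

Lemma sgnC s f : is_sgn s -> s + f = f + s.
Proof. by move=> hs; rewrite central ?sgn_dom ?sgn_cod. Qed.

Lemma sgn_move s f g : is_sgn s -> s + f = g -> f = s + g.
Proof. by move=> hs <-; rewrite aaddA sgnK // a0add. Qed.

Lemma sgn_compl s f g : is_sgn s -> cod f = dom g -> (s + g) * f = s + g * f.
Proof.
move=> hs e; rewrite -{1}(a0add f).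
by rewrite exch ?(sgn_dom hs) // acompm1 // sgn_dom.
Qed.

Lemma sgn_compr s f g : is_sgn s -> cod f = dom g -> g * (s + f) = s + g * f.
Proof.
move=> hs e; rewrite -{1}(a0add g).
by rewrite exch ?(sgn_cod hs) // acomp1m // sgn_cod.
Qed.

Lemma sgn_addr s f g : is_sgn s -> f + (s + g) = s + (f + g).
Proof. by move=> hs; rewrite !aaddA (sgnC f). Qed.

Definition xpow (n : nat) : A := iter n (padd x) pzero.

Lemma xpD m n : xpow (m + n) = (xpow m + xpow n)%perm.
Proof. by elim: m => [|m IH]; rewrite ?p0add //= IH paddA. Qed.

Definition X (n : nat) : arr A := aid (xpow n).

Lemma xpS n : xpow n.+1 = (x + xpow n)%perm. Proof. by []. Qed.
Lemma XS n : X n.+1 = aid x + X n. Proof. by rewrite /X xpS aid_add. Qed.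

Lemma XD m n : X (m + n) = X m + X n.
Proof. by rewrite /X xpD aid_add. Qed.

Lemma X0 : X 0 = aid pzero. Proof. by []. Qed.
Lemma X1 : X 1 = aid x. Proof. by rewrite XS X0 aadd0. Qed.

Arguments xpow : simpl never.
Arguments X : simpl never.

Lemma addXX f m n : f + X m + X n = f + X (m + n).
Proof. by rewrite XD aaddA. Qed.

Lemma xp_add m n : (xpow m + xpow n)%perm = xpow (m + n). Proof. by rewrite xpD. Qed.
Lemma xp_addr p m n : (p + xpow m + xpow n)%perm = (p + xpow (m + n))%perm.
Proof. by rewrite xpD paddA. Qed.
Lemma x_xp n : (x + xpow n)%perm = xpow n.+1. Proof. by []. Qed.
Lemma x_xpr p n : (p + x + xpow n)%perm = (p + xpow n.+1)%perm.
Proof. by rewrite xpS paddA. Qed.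
Lemma xp_x n : (xpow n + x)%perm = xpow n.+1.
Proof. by rewrite -addn1 xpD -[xpow 1]/(x + pzero)%perm padd0. Qed.
Lemma xp_xr p n : (p + xpow n + x)%perm = (p + xpow n.+1)%perm.
Proof. by rewrite -paddA xp_x. Qed.

Lemma addxX f n : f + aid x + X n = f + X n.+1.
Proof. by rewrite XS aaddA. Qed.
Lemma addXx f n : f + X n + aid x = f + X n.+1.
Proof. by rewrite -aaddA -aid_add xp_x. Qed.

(** Composability conditions are equations between objects: adjacent powers of [x] are merged and
    the exponents compared. *)
Ltac solve_ob_pow := rewrite /= ?cod_comp /= ?padd0 ?p0add ?paddA;
  repeat match goal with
    | H : is_sgn _ |- _ => progress rewrite ?(sgn_dom H) ?(sgn_cod H) ?padd0 ?p0add
    | H : dom _ = _ |- _ => progress rewrite ?H ?paddA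
    | H : cod _ = _ |- _ => progress rewrite ?H ?paddA
  end;
  rewrite ?(xp_add, xp_addr, x_xp, x_xpr, xp_x, xp_xr) ?addnS ?addn0 ?addSn ?add0n
    ?addnA //=;
  try solve [repeat (f_equal; try lia)];
  try (rewrite dom_comp; solve_ob_pow).

(** By the hexagon, moving [x] past each factor of [xpow n] costs one [t]. *)
Lemma bet_xx1 n : exists2 s, is_sgn s & bet x (xpow n) = s + (aid x + X n).
Proof.
elim: n => [|n [s hs IH]].
  by exists (aid pzero); [exact: sgn0 | rewrite bet0 a0add X0 aadd0].
have ht : is_sgn (Arr t) by right.
exists (s + Arr t); first exact: sgnD.
rewrite xpS bet_hex IH bet_xx XS.
rewrite (sgn_addr _ _ hs) -(aaddA (Arr t)) -!aid_add.
rewrite (sgn_compl hs) ?(sgn_compr ht) //; try by solve_ob_pow.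
by rewrite acomp1m ?aaddA ?paddA; solve_ob_pow.
Qed.

Lemma bet_xp m n : exists2 s, is_sgn s & bet (xpow m) (xpow n) = s + X (m + n).
Proof.
elim: m => [|m [s hs IH]].
  by exists (aid pzero); [exact: sgn0 | rewrite bet0l a0add].
have [s' hs' IH'] := bet_xx1 n.
exists (s + s'); first exact: sgnD.
rewrite xpS bet_hexl IH IH' addSn XS -(aaddA s') (sgn_addr _ _ hs) XD -!aid_add.
rewrite (sgn_compl hs') ?(sgn_compr hs) //; try by solve_ob_pow.
rewrite acomp1m; try by solve_ob_pow.
rewrite (sgnC s' hs) aaddA. congr (_ + aid _); solve_ob_pow.
Qed.

(* Naturality of the symmetry with respect to [f], the symmetries between powers
   of [x] being signs. *)
Lemma bet_xp_nat n p a b f : dom f = (p + xpow b)%perm -> cod f = xpow a ->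
  exists2 s, is_sgn s & (f + X n) * (bet (xpow n) p + X b) = s + (X n + f).
Proof.
move=> ed ec; have [s hs es] := bet_xp n a; have [s' hs' es'] := bet_xp n b.
have e := @bet_nat A (X n) f _ _ _ _ erefl erefl ed ec.
rewrite es bet_hex es' in e.
exists (s' + s); first exact: sgnD.
rewrite -aaddA; apply: sgn_move => //.
rewrite (sgn_addr _ _ hs') -aid_add (sgn_compl hs') ?acomp1m in e; try by solve_ob_pow.
rewrite (sgn_compr hs') in e; try by solve_ob_pow.
by rewrite -e (sgn_compl hs) ?acomp1m //; solve_ob_pow.
Qed.

(** Here [f] and [g] stand for the maps [phi] of two words. Up to sign, swapping the words exchanges
    the order in which they are cancelled: naturality trades the symmetry of [p] and [q] for
    symmetries with powers of [x], which [bet_xp_nat] turns into signs. *)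
Lemma bet_braid p q a b c e f g :
  dom f = (p + xpow b)%perm -> cod f = xpow a ->
  dom g = (q + xpow e)%perm -> cod g = xpow c ->
  exists2 s, is_sgn s &
  (g + X a) * (aid q + f + X e) * (bet p q + X (b + e))
    = s + (f + X c) * (aid p + g + X b).
Proof.
move=> fd fc gd gc.
have [s hs es] := bet_xp_nat a gd gc; have [s' hs' es'] := bet_xp_nat b gd gc.
(* Moving [q] past the whole source [p + xpow b] of [f] makes naturality applicable; the surplus
   move past [xpow b] is undone afterwards. *)
have e1 : (aid q + f) * (bet p q + X b)
    = bet (xpow a) q * (f + aid q) * (aid p + bet q (xpow b)).
  rewrite (@bet_nat A f (aid q) _ _ _ _ fd fc erefl erefl) bet_hexl.
  rewrite -!acompA; try by solve_ob_pow.
  by rewrite -lcomp // betK -!aid_add acompm1; solve_ob_pow.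
exists (s + s'); first exact: sgnD.
rewrite XD aaddA -acompA; try by solve_ob_pow.
rewrite -rcomp ?e1; try by solve_ob_pow.
rewrite !rcomp; try by solve_ob_pow.
rewrite !acompA; try by solve_ob_pow.
rewrite es (sgn_compl hs); try by solve_ob_pow.
rewrite (sgn_compl hs); try by solve_ob_pow.
have e2 : (X b + g) * (bet q (xpow b) + X e) = s' + (g + X b).
  apply: sgn_move => //.
  rewrite -(sgn_compl hs') -?es' -?acompA; try by solve_ob_pow.
  by rewrite -rcomp // betK -!aid_add acompm1 //; solve_ob_pow.
rewrite -aaddA -aid_add -(split_r (f := f) (g := g)) //.
rewrite (@split_l _ f g (xpow c) (p + xpow b)%perm) //.
rewrite -(acompA (h := f + _)); try by solve_ob_pow.
rewrite aid_add -!aaddA -lcomp ?e2; try by solve_ob_pow.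
rewrite (sgn_addr _ _ hs') (sgn_compr hs') ?aaddA //; solve_ob_pow.
Qed.

(** * Words in [x] and [y] and the cancellation maps [phi] *)

(* A word is a list of booleans, [true] standing for [x] and [false] for [y]. *)
Definition word_ob (w : seq bool) : A :=
  foldr (fun b p => (if b then x else y) + p)%perm pzero w.

Lemma word_ob_cat w v : word_ob (w ++ v) = (word_ob w + word_ob v)%perm.
Proof. by elim: w => [|b w IH] /=; rewrite ?p0add // IH paddA. Qed.

Definition nx (w : seq bool) := count id w.
Definition ny (w : seq bool) := count negb w.

Lemma nx_cat w v : nx (w ++ v) = (nx w + nx v)%N. Proof. exact: count_cat. Qed.
Lemma ny_cat w v : ny (w ++ v) = (ny w + ny v)%N. Proof. exact: count_cat. Qed.
Lemma nx_cons b w : nx (b :: w) = (b + nx w)%N. Proof. by []. Qed.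
Lemma ny_cons b w : ny (b :: w) = (~~ b + ny w)%N. Proof. by []. Qed.
Arguments nx : simpl never.
Arguments ny : simpl never.

(* [phi w : w + x^(ny w) -> x^(nx w)] *)
Fixpoint phi (w : seq bool) : arr A :=
  match w with
  | [::] => aid pzero
  | true :: w => aid x + phi w
  | false :: w => (Arr ieta + X (nx w)) * (aid y + phi w + aid x)
  end.

Lemma phi_codom w :
  dom (phi w) = (word_ob w + xpow (ny w))%perm /\ cod (phi w) = xpow (nx w).
Proof.
elim: w => [|[] w [IH1 IH2]]; rewrite ?nx_cons ?ny_cons /=.
- by rewrite /nx /ny /xpow padd0.
- by rewrite IH1 IH2; split; solve_ob_pow.
by split; solve_ob_pow.
Qed.

Lemma phi_dom w : dom (phi w) = (word_ob w + xpow (ny w))%perm.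
Proof. by case: (phi_codom w). Qed.
Lemma phi_cod w : cod (phi w) = xpow (nx w).
Proof. by case: (phi_codom w). Qed.

Lemma phi_iso w : aiso (phi w).
Proof.
elim: w => [|[] w IH] /=; first exact: aiso_id.
  by apply: aiso_add => //; apply: aiso_id.
apply: aiso_comp; first by rewrite /= phi_cod /=; solve_ob_pow.
  by apply: aiso_add; [apply: aiso_add => // |]; apply: aiso_id.
apply: aiso_add; last exact: aiso_id.
by exists (Arr (pd_eta d)); apply: ainv_sym.
Qed.

Ltac solve_ob_phi := rewrite ?phi_dom ?phi_cod /= ?phi_dom ?phi_cod 
    ?word_ob_cat ?nx_cat ?ny_cat ?nx_cons ?ny_cons /=; solve_ob_pow;
   try (rewrite ?phi_dom ?phi_cod; solve_ob_pow).

(** The word [v] is cancelled first, next to the [X (ny w)] reserved for [w]. The two steps are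
    composable because the order of two powers of [x] does not matter on objects. *)
Lemma phi_cat w v : phi (w ++ v)
  = (phi w + X (nx v)) * (aid (word_ob w) + phi v + X (ny w)).
Proof.
elim: w => [|[] w IH]; rewrite ?nx_cons ?ny_cons /=.
- by rewrite /ny /= X0 aadd0 !a0add acomp1m //; solve_ob_phi.
- by rewrite IH lcomp ?aid_add ?aaddA ?add0n //=; solve_ob_phi.
rewrite IH lcomp ?rcomp; try by solve_ob_phi.
rewrite !acompA; try by solve_ob_phi.
by rewrite nx_cat XD !aid_add !aaddA addXx addxX addXx.
Qed.

(** * Stable morphisms and their closure properties *)

(** Up to sign and padding, [stab_eq] says that [f] followed by [phi v] is [phi w]; the two counting
    conditions make its sides parallel. *)
Record stab_at (w v : seq bool) f s (i j : nat) : Prop := StabAt {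
  stab_sgn : is_sgn s;
  stab_dom : dom f = word_ob w;
  stab_cod : cod f = word_ob v;
  stab_nx : (nx v + i = nx w + j)%N;
  stab_ny : (ny v + i = ny w + j)%N;
  stab_eq : (phi v + X i) * (f + X (ny v + i)) = s + (phi w + X j)
}.

(* The padding exponents [i] and [j] compensate for the different numbers of
   letters of [w] and [v]. *)
Definition stable w v f : Prop := exists s i j, stab_at w v f s i j.

Lemma stable_id w : stable w w (aid (word_ob w)).
Proof.
exists (aid pzero), 0%N, 0%N; split=> //; first exact: sgn0.
by rewrite X0 aadd0 a0add addn0 -aid_add acompm1 //; solve_ob_phi.
Qed.

(** Each of the two equations is padded by an exponent of the other, so that they can be chained;
    the signs add up. *)
Lemma stable_comp w v u f g : stable w v f -> stable v u g ->
  stable w u (g * f).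
Proof.
move=> [s' [i' [j' [hs' fd fc nx' ny' ef]]]] [s [i [j [hs gd gc nx1 ny1 eg]]]].
have gf : cod f = dom g by rewrite fc gd.
exists (s + s'), (i + i')%N, (j' + j)%N; split.
- exact: sgnD.
- by rewrite dom_comp.
- by rewrite cod_comp.
- lia.
- lia.
rewrite rcomp // acompA; try by solve_ob_phi.
rewrite addnA -(addXX _ i i') -!(addXX _ (ny u + i)%N i') -(addXX _ j' j).
rewrite -rcomp; last by solve_ob_phi.
rewrite eg -aaddA (sgn_compl hs); last by solve_ob_phi.
have -> : phi v + X j + X i' = phi v + X i' + X j by rewrite !addXX addnC.
have -> : f + X (ny u + i) + X i' = f + X (ny v + i') + X j.
  by rewrite !addXX; congr (_ + X _); lia.
rewrite -rcomp; last by solve_ob_phi.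
by rewrite ef !aaddA.
Qed.

(** The equation is precomposed with the padded inverse: [i] and [j] trade places, and the sign
    stays because it is its own inverse. *)
Lemma stable_inv w v f g : stable w v f -> ainv f g -> stable v w g.
Proof.
move=> [s [i [j [hs fd fc nx1 ny1 /esym/(sgn_move hs) e]]]] [gd gc gf fg].
exists s, j, i; split; rewrite ?gd ?gc //.
rewrite e (sgn_compl hs) -?acompA -?ny1; try by solve_ob_phi.
by rewrite -rcomp ?fg ?fc -?aid_add ?acompm1 //; solve_ob_phi.
Qed.

(** After splitting with [phi_cat], the equation of [f'] is applied inside the sum and then that of
    [f] outside; interchange keeps the two apart. *)
Lemma stable_add w v w' v' f f' : stable w v f -> stable w' v' f' ->
  stable (w ++ w') (v ++ v') (f + f').
Proof.
move=> [s [i [j [hs fd fc nx1 ny1 ef]]]] [s' [i' [j' [hs' fd' fc' nx' ny' ef']]]].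
exists (s' + s), (i + i')%N, (j + j')%N; split.
- exact: sgnD.
- by rewrite word_ob_cat /= fd fd'.
- by rewrite word_ob_cat /= fc fc'.
- rewrite !nx_cat; lia.
- rewrite !ny_cat; lia.
rewrite !phi_cat !rcomp; try by solve_ob_phi.
rewrite -acompA; try by solve_ob_phi.
have -> : aid (word_ob v) + phi v' + X (ny v) + X (i + i')
    = aid (word_ob v) + (phi v' + X i') + X (ny v + i).
  by rewrite aaddA !addXX; congr (_ + X _); lia.
have -> : f + f' + X (ny (v ++ v') + (i + i'))
    = f + (f' + X (ny v' + i')) + X (ny v + i).
  by rewrite aaddA !addXX ny_cat; congr (_ + X _); lia.
rewrite (@exch _ (f + _) _ (X (ny v + i))); try by solve_ob_phi.
rewrite (@exch _ f _ (f' + _)); try by solve_ob_phi.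
rewrite ef' !acomp1m // (sgn_addr _ _ hs') -(aaddA s').
rewrite (sgn_compr hs'); last by solve_ob_phi.
rewrite -(aaddA f) addXX.
rewrite (@split_l _ f _ (xpow (nx w' + j' + (ny v + i))) (word_ob w)) //; last by solve_ob_phi.
rewrite !acompA; try by solve_ob_phi.
have -> : phi v + X (nx v') + X (i + i') = phi v + X i + X (nx v' + i').
  by rewrite !addXX; congr (_ + X _); lia.
rewrite -/(X _).
have -> : f + X (nx w' + j' + (ny v + i)) = f + X (ny v + i) + X (nx v' + i').
  by rewrite addXX; congr (_ + X _); lia.
rewrite -(rcomp _ (g := phi v + X i)); last by solve_ob_phi.
rewrite ef -/(X (nx v' + i')) -/(X (j + j')) -(aaddA s).
rewrite (sgn_compl hs); last by solve_ob_phi.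
rewrite -(aaddA s') !addXX !aaddA.
by congr (_ + (_ + X _) * (_ + X _)); lia.
Qed.

Lemma stable_bet w v : stable (w ++ v) (v ++ w) (bet (word_ob w) (word_ob v)).
Proof.
have [s hs e] := bet_braid (phi_dom w) (phi_cod w) (phi_dom v) (phi_cod v).
exists s, 0%N, 0%N; split; rewrite ?word_ob_cat ?nx_cat ?ny_cat //; try lia.
by rewrite X0 !aadd0 addn0 (addnC (ny v)) !phi_cat e.
Qed.

Lemma stable_eta : stable [::] [:: false; true] (Arr (pd_eta d)).
Proof.
(* The target word has one letter [y], so the empty source word needs one [x] of padding. *)
exists (aid pzero), 0%N, 1%N; split; rewrite /= ?padd0 //; first exact: sgn0.
change (((Arr ieta + X 1) * (aid y + (aid x + aid pzero) + aid x) + X 0)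
  * (Arr (pd_eta d) + X 1) = aid pzero + (aid pzero + X 1)).
rewrite X0 !aadd0 !a0add X1 -!aid_add acompm1 -?rcomp //; try by solve_ob_pow.
by case: ietaP => _ _ -> _; rewrite -aid_add p0add.
Qed.

(** [phi] of the word [x y] is [aid x + Arr ieta], and the triangle identity equates this with
    [eps + aid x]. *)
Lemma stable_eps : stable [:: true; false] [::] (Arr (pd_eps d)).
Proof.
exists (aid pzero), 1%N, 0%N; split; rewrite /= ?padd0 //; first exact: sgn0.
change ((aid pzero + X 1) * (Arr (pd_eps d) + X 1) = aid pzero +
  (aid x + (Arr ieta + X 0) * (aid y + aid pzero + aid x) + X 0)).
rewrite X0 !aadd0 !a0add acomp1m //; last by solve_ob_pow.
rewrite -aid_add acompm1 //.
rewrite X1; case: ietaP => e1 e2 e3 e4.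
rewrite -[LHS](@acompm1 _ (x + y + x)%perm) //.
have <- : (aid x + Arr (pd_eta d)) * (aid x + Arr ieta) = aid (x + y + x)%perm.
  by rewrite -lcomp // e4 -aid_add /= paddA.
by rewrite acompA ?zig_left ?acomp1m //; solve_ob_pow.
Qed.
Lemma add_cancelX n f g : f + X n = g + X n -> dom f = dom g ->
  cod f = cod g -> f = g.
Proof.
move=> e ed ec; elim: n e => [|n IH] e; first by rewrite -(aadd0 f) -(aadd0 g).
apply: IH; apply: (@add_cancel A d); rewrite ?addXx //= ?ed ?ec //.
Qed.

Lemma add_liftX n p q f : dom f = (p + xpow n)%perm -> cod f = (q + xpow n)%perm ->
  exists g, dom g = p /\ cod g = q.
Proof.
elim: n f => [|n IH] f; first by rewrite /xpow !padd0 => fd fc; exists f.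
rewrite -!xp_xr => fd fc.
by have [g [gd gc _]] := add_lift fd fc; apply: (IH g).
Qed.

(** Padded to a common exponent, the two equations have the same right-hand side up to sign. Then
    [phi v] is inverted and the power of [x] cancelled. *)
Lemma stable_parallel w v f g : stable w v f -> stable w v g ->
  exists2 s, is_sgn s & f = s + g.
Proof.
move=> [s [i [j [hs fd fc nx1 ny1 ef]]]] [s' [i' [j' [hs' gd gc nx' ny' eg]]]].
have hss := sgnD hs hs'; exists (s + s') => //.
have [h [/= hd hc e1 e2]] : aiso (phi v + X (i + i')).
  by apply: aiso_add; [exact: phi_iso | exact: aiso_id].
apply: (@add_cancelX (ny v + (i + i'))); try by solve_ob_pow.
have ef' : (phi v + X (i + i')) * (f + X (ny v + (i + i')))
    = s + (phi w + X (j + i')).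
  rewrite addnA -!(addXX _ _ i') -rcomp; last by solve_ob_phi.
  by rewrite -/(X i') ef !aaddA.
have eg' : (phi v + X (i + i')) * (g + X (ny v + (i + i')))
    = s' + (phi w + X (j + i')).
  (* Both [j - i] and [j' - i'] are the difference [nx v - nx w]. *)
  rewrite (addnC i) addnA (_ : j + i' = j' + i)%N; last by lia.
  rewrite -!(addXX _ _ i) -rcomp; last by solve_ob_phi.
  by rewrite -/(X i) eg !aaddA.
have {}eg' := sgn_move hs' (esym eg').
have := congr1 (acomp h) ef'.
rewrite eg' acompA ?e1; [|by solve_ob_phi|by rewrite hd].
rewrite acomp1m; last by solve_ob_phi.
move=> ->; rewrite aaddA (sgn_compr hss); last by rewrite cod_comp hd.
rewrite acompA ?e1 ?hd //; last by solve_ob_phi.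
by rewrite acomp1m ?aaddA //; solve_ob_phi.
Qed.

(** With enough padding [phi w] and [phi v] end at the same power of [x]; the first followed by the
    inverse of the second is a morphism from which the padding is removed. *)
Lemma hom_of_words w v : (nx w + ny v = nx v + ny w)%N ->
  exists f, dom f = word_ob w /\ cod f = word_ob v.
Proof.
move=> e; have [h [hd hc _ _]] := phi_iso v.
apply: (@add_liftX (ny w + ny v) _ _ ((h + X (ny w)) * (phi w + X (ny v)))).
  by rewrite dom_comp /= ?hd; solve_ob_phi.
by rewrite cod_comp /= hc; solve_ob_phi.
Qed.

End Stabilisation.

(** * Functors acting on total morphisms; strict functors *)

Definition amap (C D : category) (F : functor C D) (f : arr C) : arr D :=
  Arr (fmap F (mor f)).

Lemma feqP (C D : category) (F G : functor C D) :
  feq F G <-> amap F =1 amap G.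
Proof.
by split=> [e [a b f]|e a b f]; apply/heqP; [exact: e | exact: (e (Arr f))].
Qed.

Lemma amap_id (C D : category) (F : functor C D) a : amap F (aid a) = aid (F a).
Proof. by rewrite /amap /= fmap1. Qed.

Lemma amap_comp (C D : category) (F : functor C D) (f g : arr C) :
  cod f = dom g -> amap F (g * f) = amap F g * amap F f.
Proof.
case: f g => [a b f] [b' c g] /= e; case: b' / e g => g.
by rewrite acompE /amap /= acompE fmapM.
Qed.

Lemma amap_inv (C D : category) (F : functor C D) (f g : arr C) :
  ainv f g -> ainv (amap F f) (amap F g).
Proof.
case=> e1 e2 e3 e4; split; rewrite /= ?e1 ?e2 //.
  by rewrite -amap_comp // e3 amap_id.
by rewrite -amap_comp // e4 amap_id.
Qed.

Section Strict.
Variables (A B : permcat) (F : strictfunctor A B).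

Lemma strict_ob a b : F (a + b)%perm = (F a + F b)%perm.
Proof. by have [h _] := strictP F; have [_ ->] := heq_ob (h a b). Qed.

Lemma strict0 : F pzero = pzero.
Proof. by have [_ h] := strictP F; have [_ ->] := heq_ob h. Qed.

Lemma strict_sm2 a b : Arr (sm2 F a b) = aid (F a) + aid (F b).
Proof. by have [h _] := strictP F; rewrite -aid_add; apply/heqP. Qed.

Lemma amap_add (f g : arr A) : amap F (f + g) = amap F f + amap F g.
Proof.
case: f g => [a b f] [c e g]; have /(congr1 Arr) := sm2_nat F f g.
rewrite -!acompE !strict_sm2 -!aid_add acompm1 /= ?strict_ob // => h.
by rewrite [LHS]h acomp1m.
Qed.

Lemma amap_bet a b : amap F (bet a b) = bet (F a) (F b).
Proof.
have /(congr1 Arr) := sm2_beta F a b.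
rewrite -!acompE !strict_sm2 -!aid_add acompm1 /= ?strict_ob // => h.
by rewrite [LHS]h acomp1m.
Qed.

End Strict.

Lemma is_strict_comp (A B C : permcat) (G : strictfunctor B C)
    (F : strictfunctor A B) : is_strict (smcomp G F).
Proof.
split=> [a b|]; apply/heqP => /=.
  rewrite -acompE strict_sm2 -[Arr (fmap _ _)]/(amap G (Arr (sm2 F a b))).
  by rewrite strict_sm2 -aid_add amap_id -aid_add acomp1m //= strict_ob.
have [_ /heqP eG] := strictP G; have [_ /heqP eF] := strictP F.
rewrite -acompE eG -[Arr (fmap _ _)]/(amap G (Arr (sm0 F))) eF.
by rewrite amap_id acomp1m //= strict0.
Qed.

Definition strict_comp (A B C : permcat) (G : strictfunctor B C)
    (F : strictfunctor A B) : strictfunctor A C :=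
  StrictFunctor (is_strict_comp G F).

Lemma amap_fcomp (A B C : category) (G : functor B C) (F : functor A B) f :
  amap (fcomp G F) f = amap G (amap F f).
Proof. by []. Qed.

Section ZigMap.
Variables (A B : permcat) (F : strictfunctor A B).
Variables (d : pairdata A) (e : pairdata B).
Hypothesis de : maps_pair F d e.

Lemma arr_zigl (C : permcat) (c : pairdata C) : Arr (zigl c)
  = (Arr (pd_eps c) + aid (pd_l c)) * (aid (pd_l c) + Arr (pd_eta c)).
Proof.
rewrite /zigl -!acompE !arr_idto acompm1; last by solve_ob.
by rewrite acomp1m ?acompm1; solve_ob.
Qed.

Lemma arr_zigr (C : permcat) (c : pairdata C) : Arr (zigr c)
  = (aid (pd_r c) + Arr (pd_eps c)) * (Arr (pd_eta c) + aid (pd_r c)).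
Proof.
rewrite /zigr -!acompE !arr_idto acompm1; last by solve_ob.
by rewrite acomp1m ?acompm1; solve_ob.
Qed.

Lemma amap_zigl : amap F (Arr (zigl d)) = Arr (zigl e).
Proof.
have [e1 e2 /heqP e3 /heqP e4] := de.
rewrite !arr_zigl amap_comp /= ?paddA // !amap_add !amap_id e1.
by rewrite -[Arr (pd_eps e)]e4 -[Arr (pd_eta e)]e3.
Qed.

Lemma amap_zigr : amap F (Arr (zigr d)) = Arr (zigr e).
Proof.
have [e1 e2 /heqP e3 /heqP e4] := de.
rewrite !arr_zigr amap_comp /= ?paddA // !amap_add !amap_id e2.
by rewrite -[Arr (pd_eps e)]e4 -[Arr (pd_eta e)]e3.
Qed.

End ZigMap.

Lemma maps_pair_comp (A B C : permcat) (G : strictfunctor B C)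
    (F : strictfunctor A B) a b c :
  maps_pair F a b -> maps_pair G b c -> maps_pair (strict_comp G F) a c.
Proof.
move=> [e1 e2 /heqP e3 /heqP e4] [h1 h2 /heqP h3 /heqP h4].
split; rewrite /= ?e1 ?e2 //; apply/heqP.
  by rewrite -[LHS]/(amap G (Arr (fmap F (pd_eta a)))) e3.
by rewrite -[LHS]/(amap G (Arr (fmap F (pd_eps a)))) e4.
Qed.

(** * Free permutative categories and the pushouts adjoining isomorphisms or relations *)

Lemma feq_free (S : forall C, freeperm C) (C : category) (A : permcat)
    (F G : strictfunctor (S C) A) :
  (forall f, amap F (amap (fp_in (S C)) f) = amap G (amap (fp_in (S C)) f)) ->
  amap F =1 amap G.
Proof.
move=> h f.
have /feqP e1 : feq F (fp_lift (S C) (fcomp G (fp_in (S C)))).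
  by apply: fp_lift_uniq; apply/feqP => g; apply: h.
have /feqP e2 : feq G (fp_lift (S C) (fcomp G (fp_in (S C)))).
  by apply: fp_lift_uniq; apply/feqP.
by rewrite e1 e2.
Qed.

Lemma amap_lift (C : category) (S : freeperm C) (A : permcat) (F : functor C A) f :
  amap (fp_lift S F) (amap (fp_in S) f) = amap F f.
Proof. by have /feqP := fp_liftE S F; apply. Qed.

Lemma amap_free_map (S : forall C, freeperm C) (C D : category)
    (F : functor C D) f :
  amap (free_map S F) (amap (fp_in (S C)) f) = amap (fp_in (S D)) (amap F f).
Proof. exact: amap_lift. Qed.

Lemma amap_ob (C D : category) (F G : functor C D) a :
  amap F =1 amap G -> F a = G a.
Proof. by move=> e; apply: (congr1 (@dom _) (e (aid a))). Qed.

Lemma pushout_eq (A B C D E : permcat) (f : strictfunctor A B)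
    (g : strictfunctor A C) (h : strictfunctor B D) (k : strictfunctor C D)
    (F G : strictfunctor D E) :
  is_pushout f g h k -> (forall u, amap F (amap h u) = amap G (amap h u)) ->
  (forall u, amap F (amap k u) = amap G (amap k u)) -> amap F =1 amap G.
Proof.
move=> [/feqP c univ] eh ek.
have [|w _ wu] := univ E (strict_comp F h) (strict_comp F k).
  by apply/feqP => u; apply: (congr1 (amap F) (c u)).
have /feqP eF : feq F w by apply: wu; apply/feqP.
have /feqP eG : feq G w 
  by apply: wu; apply/feqP => u; [exact: esym (eh u) | exact: esym (ek u)].
by move=> u; rewrite eF eG.
Qed.

Program Definition isofun (C : category) (u v : C) (f : hom u v) (g : hom v u)
    (gf : (g \o f)%perm = idm u) (fg : (f \o g)%perm = idm v) : functor isocat C :=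
  {| fob := arr_ob u v;
     fmap := fun s t => match s, t return unit -> hom (arr_ob u v s) (arr_ob u v t) with
       | pa, pa => fun=> idm u | pa, pb => fun=> f
       | pb, pa => fun=> g | pb, pb => fun=> idm v end |}.
Next Obligation. by move=> C u v f g gf fg []. Qed.
Next Obligation. 
by move=> C u v f g gf fg [] [] [] _ _ /=; rewrite ?comp1m ?compm1 ?gf ?fg.
Qed.

Definition iso_gen : arr isocat := @Arr isocat pa pb tt.

Lemma disc_arr (f : arr disccat) : f = aid (pa : disccat) \/ f = aid (pb : disccat).
Proof. by case: f => [[] [] []]; [left|right]. Qed.

Section Steps.
Variables (S : forall C, freeperm C) (A B D : permcat).
Implicit Types (k : strictfunctor (S isocat) D) (l : strictfunctor (S singlecat) D).
Implicit Types (j : strictfunctor B D) (v : strictfunctor B A) (F G : strictfunctor D A).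

(** The pushout freely adjoins an isomorphism from [p] to [q], so an extension of [v] may send it to
    any isomorphism with the right endpoints; [iso_pushout_eq] is the matching uniqueness. *)
Lemma iso_pushout_lift (p q : B) k j v (f : arr A) :
  is_pushout (free_map S pfun) (fp_lift (S disccat) (discfun p q)) k j ->
  dom f = v p -> cod f = v q -> aiso f ->
  exists w : strictfunctor D A, (forall u, amap w (amap j u) = amap v u) /\
    amap w (amap k (amap (fp_in (S isocat)) iso_gen)) = f.
Proof.
case: f => [a b f] [_ univ] /= ea eb /is_iso_arr[g [gf fg]]; subst a b.
pose F := isofun gf fg.
have [|w [/feqP e1 /feqP e2] _] := univ A (fp_lift (S isocat) F) v.
  apply/feqP; apply: (@feq_free S _ _ (strict_comp _ _) (strict_comp _ _)) => u.
  rewrite !amap_fcomp amap_free_map !amap_lift.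
  by case: (disc_arr u) => ->; rewrite !amap_id.
exists w; split=> //.
by rewrite -amap_fcomp e1 amap_lift.
Qed.

Lemma iso_pushout_eq (p q : B) k j F G :
  is_pushout (free_map S pfun) (fp_lift (S disccat) (discfun p q)) k j ->
  (forall u, amap F (amap j u) = amap G (amap j u)) ->
  amap F (amap k (amap (fp_in (S isocat)) iso_gen))
    = amap G (amap k (amap (fp_in (S isocat)) iso_gen)) ->
  amap F =1 amap G.
Proof.
move=> po ej ek; apply: (pushout_eq po) => //.
apply: (@feq_free S _ _ (strict_comp _ _) (strict_comp _ _)) => u.
rewrite !amap_fcomp.
(* Functors preserve inverses, which are unique, so agreement on the generator gives agreement on
   its inverse. *)
pose iso_gen' := @Arr isocat pb pa tt.
have inv : ainv iso_gen iso_gen' by split; rewrite ?acompE.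
have e' : amap F (amap k (amap (fp_in (S isocat)) iso_gen'))
    = amap G (amap k (amap (fp_in (S isocat)) iso_gen')).
  have i1 := amap_inv F (amap_inv k (amap_inv (fp_in (S isocat)) inv)).
  have i2 := amap_inv G (amap_inv k (amap_inv (fp_in (S isocat)) inv)).
  by rewrite ek in i1; apply: ainv_uniq i1 i2.
have ed := congr1 (@dom _) ek; have ec := congr1 (@cod _) ek.
by case: u => [[] [] []] //; rewrite -/(aid (_ : isocat)) !amap_id /= in ed ec *;
   rewrite ?ed ?ec.
Qed.

Lemma eq_pushout_lift (p q : B) (f g : hom p q) l j v :
  is_pushout (free_map S qfun) (fp_lift (S parcat) (parfun f g)) l j ->
  amap v (Arr f) = amap v (Arr g) ->
  exists w : strictfunctor D A, forall u, amap w (amap j u) = amap v u.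
Proof.
move=> [_ univ] e.
pose F : functor singlecat A := arrfun (fun _ : unit => fmap v f).
have [|w [_ /feqP e2] _] := univ A (fp_lift (S singlecat) F) v; last by exists w.
apply/feqP; apply: (@feq_free S _ _ (strict_comp _ _) (strict_comp _ _)) => u.
rewrite !amap_fcomp amap_free_map !amap_lift.
by case: u => [[] [] []] //; rewrite -/(aid (_ : parcat)) !amap_id.
Qed.

(** [qfun] merges the two parallel arrows, so the commuting square identifies their images. *)
Lemma eq_pushout_comm (p q : B) (f g : hom p q) l j :
  is_pushout (free_map S qfun) (fp_lift (S parcat) (parfun f g)) l j ->
  amap j (Arr f) = amap j (Arr g).
Proof.
move=> [/feqP c _].
have e b := c (amap (fp_in (S parcat)) (@Arr parcat pa pb b)).
have := e true; have := e false; rewrite !amap_fcomp !amap_free_map !amap_lift.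
by move=> <- <-.
Qed.

(** As [qfun] is surjective on morphisms, the leg [l] is determined by [j]: imposing a relation
    creates no new generator. *)
Lemma eq_pushout_eq (p q : B) (f g : hom p q) l j F G :
  is_pushout (free_map S qfun) (fp_lift (S parcat) (parfun f g)) l j ->
  (forall u, amap F (amap j u) = amap G (amap j u)) -> amap F =1 amap G.
Proof.
move=> po ej; apply: (pushout_eq po) => //.
apply: (@feq_free S _ _ (strict_comp _ _) (strict_comp _ _)) => u.
have [u' ->] : exists u', u = amap qfun u'.
  case: u => [[] [] []] //.
  - by exists (aid (pa : parcat)).
  - by exists (@Arr parcat pa pb true).
  - by exists (aid (pb : parcat)).
have [/feqP c _] := po.
have := c (amap (fp_in (S parcat)) u'); rewrite !amap_fcomp amap_free_map => ->.
exact: ej.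
Qed.

Lemma maps_pair_factor j v F (b : pairdata B) (c : pairdata D) (a : pairdata A) :
  maps_pair j b c -> (forall u, amap F (amap j u) = amap v u) ->
  maps_pair v b a -> maps_pair F c a.
Proof.
move=> [e1 e2 /heqP e3 /heqP e4] e [h1 h2 /heqP h3 /heqP h4].
have eo p : F (j p) = v p by apply: (congr1 (@dom _) (e (aid p))).
split; rewrite -?e1 -?e2 ?eo //; apply/heqP.
  by rewrite -[LHS]/(amap F (Arr (pd_eta c))) -[Arr (pd_eta c)]e3 -h3; apply: (e (Arr _)).
by rewrite -[LHS]/(amap F (Arr (pd_eps c))) -[Arr (pd_eps c)]e4 -h4; apply: (e (Arr _)).
Qed.

End Steps.

Lemma fp_lift_ob (C : category) (S : freeperm C) (A : permcat) (F : functor C A) c :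
  fp_lift S F (fp_in S c) = F c.
Proof. by have /feqP e := fp_liftE S F; apply: (amap_ob c e). Qed.

(** * The universal property of the free category on an invertible generator *)

Section Universal.
Variables (S : forall C, freeperm C) (P : free_invertible S).

(** The functor is extended along the four pushouts: the first two use invertibility of [eps] and
    [eta], the last two the triangle identities of [d]. *)
Lemma free_invertible_lift (A : permcat) (d : invpair A) :
  exists F : strictfunctor P A, maps_pair F (fi_gen P) d.
Proof.
have [/is_iso_arr ieta /is_iso_arr ieps zl zr] := ipP d.
pose v := fp_lift (S disccat) (discfun (pd_l d) (pd_r d)).
have va : v (fp_in (S disccat) pa) = pd_l d := fp_lift_ob _ _ _.
have vb : v (fp_in (S disccat) pb) = pd_r d := fp_lift_ob _ _ _.
have [||w1 [j1 k1]] := iso_pushout_lift (fi_po1 P) (v := v) _ _ ieps.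
- by rewrite strict_ob va vb.
- by rewrite strict0.
have o1 c : w1 (fi_j1 P c) = v c := congr1 (@dom _) (j1 (aid c)).
have e1 : amap w1 (Arr (fi_eps1 P)) = Arr (pd_eps d).
  by rewrite -k1; congr (amap w1 _); apply/esym/heqP/fi_eps1E.
have [||w2 [j2 k2]] := iso_pushout_lift (fi_po2 P) (v := w1) _ _ ieta.
- by rewrite strict0.
- by rewrite strict_ob !o1 va vb.
have o2 c : w2 (fi_j2 P c) = w1 c := congr1 (@dom _) (j2 (aid c)).
have m2 : maps_pair w2 (fi_gen2 P) d.
  split.
  - by rewrite -fi_gen2_l o2 o1 va.
  - by rewrite -fi_gen2_r o2 o1 vb.
  - apply/heqP; rewrite -k2; have /heqP e := fi_gen2_eta P.
    exact: (congr1 (amap w2) (esym e)).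
  - apply/heqP; rewrite -e1 -j2; have /heqP e := fi_gen2_eps P.
    exact: (congr1 (amap w2) (esym e)).
have [a2 b2 _ _] := m2.
have [|w3 j3] := eq_pushout_lift (fi_po3 P) (v := w2).
  by rewrite (amap_zigl m2) zl -[X in amap _ X]/(aid _) amap_id a2.
have m3 := maps_pair_factor (fi_gen3E P) j3 m2; have [a3 b3 _ _] := m3.
have [|w4 j4] := eq_pushout_lift (fi_po4 P) (v := w3).
  by rewrite (amap_zigr m3) zr -[X in amap _ X]/(aid _) amap_id b3.
by exists w4; apply: maps_pair_factor (fi_genE P) j4 m3.
Qed.

(** [eta] and [eps] are images of the isomorphism in [isocat]. The first triangle identity is
    imposed in the third stage and carried along [fi_j4], the second in the last stage. *)
Lemma fi_gen_invertible : is_invertible_pair (fi_gen P).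
Proof.
have [a3 b3 /heqP eta3 /heqP eps3] := fi_gen3E P.
have [a4 b4 /heqP eta4 /heqP eps4] := fi_genE P.
have i : aiso iso_gen by exists (@Arr isocat pb pa tt); split; rewrite ?acompE.
have im (C D : category) (F : functor C D) f : aiso f -> aiso (amap F f).
  by case=> g /(amap_inv F); exists (amap F g).
split.
- apply/is_iso_arr; rewrite -[Arr _]eta4; apply: (im _ _ (fi_j4 P) (Arr (pd_eta _))).
  rewrite -[Arr _]eta3; apply: (im _ _ (fi_j3 P) (Arr (pd_eta _))).
  by have /heqP <- := fi_gen2_eta P; exact: (im _ _ _ _ (im _ _ _ _ i)).
- apply/is_iso_arr; rewrite -[Arr _]eps4; apply: (im _ _ (fi_j4 P) (Arr (pd_eps _))).
  rewrite -[Arr _]eps3; apply: (im _ _ (fi_j3 P) (Arr (pd_eps _))).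
  have /heqP <- := fi_gen2_eps P; apply: (im _ _ (fi_j2 P) (Arr _)).
  by have /heqP <- := fi_eps1E P; exact: (im _ _ _ _ (im _ _ _ _ i)).
- apply/heq_eq/heqP; rewrite -(amap_zigl (fi_genE P)) -(amap_zigl (fi_gen3E P)).
  by rewrite (eq_pushout_comm (fi_po3 P)) -[Arr (idm _)]/(aid _) !amap_id a3 a4.
apply/heq_eq/heqP; rewrite -(amap_zigr (fi_genE P)) (eq_pushout_comm (fi_po4 P)).
by rewrite -[Arr (idm _)]/(aid _) amap_id b4.
Qed.

(** The pushouts are peeled off from the last to the first, until only the values at [x] and [y]
    remain to be compared. *)
Lemma free_invertible_uniq (A : permcat) (d : pairdata A) (F G : strictfunctor P A) :
  maps_pair F (fi_gen P) d -> maps_pair G (fi_gen P) d -> amap F =1 amap G.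
Proof.
move=> mF mG.
have mF3 := maps_pair_comp (fi_genE P) mF; have mG3 := maps_pair_comp (fi_genE P) mG.
have [f1 f2 /heqP f3 /heqP f4] := maps_pair_comp (fi_gen3E P) mF3.
have [g1 g2 /heqP g3 /heqP g4] := maps_pair_comp (fi_gen3E P) mG3.
apply: (eq_pushout_eq (fi_po4 P)).
apply: (eq_pushout_eq (F := strict_comp F (fi_j4 P))
  (G := strict_comp G (fi_j4 P)) (fi_po3 P)).
set F2 := strict_comp _ (fi_j3 P) in f1 f2 f3 f4 *.
set G2 := strict_comp _ (fi_j3 P) in g1 g2 g3 g4 *.
apply: (iso_pushout_eq (F := F2) (G := G2) (fi_po2 P)); last first.
  have /heqP e := fi_gen2_eta P.
  by rewrite [amap (fi_k2 P) (amap _ _)]e; etransitivity; [exact: f3 | exact: esym].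
apply: (iso_pushout_eq (F := strict_comp F2 (fi_j2 P))
  (G := strict_comp G2 (fi_j2 P)) (fi_po1 P)); last first.
  have /heqP e := fi_eps1E P; have /heqP e' := fi_gen2_eps P.
  rewrite [amap (fi_k1 _) (amap _ _)]e !amap_fcomp [amap (fi_j2 _) _]e'.
  by etransitivity; [exact: f4 | exact: esym].
apply: (feq_free (F := strict_comp (strict_comp F2 _) _)
  (G := strict_comp (strict_comp G2 _) _)) => u.
rewrite !amap_fcomp; case: (disc_arr u) => ->; rewrite !amap_id; congr aid.
  by rewrite [fi_j2 _ _]fi_gen2_l; etransitivity; [exact: f1 | exact: esym].
by rewrite [fi_j2 _ _]fi_gen2_r; etransitivity; [exact: f2 | exact: esym].
Qed.

End Universal.

(** * Wide sub-permutative categories *)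

Section SubPerm.
Variables (A : permcat) (R : arr A -> Prop).
Hypothesis R_id : forall a, R (aid a).
Hypothesis R_comp : forall f g, cod f = dom g -> R f -> R g -> R (g * f).
Hypothesis R_add : forall f g, R f -> R g -> R (f + g).
Hypothesis R_bet : forall a b, R (bet a b).

Definition sub_hom (a b : A) : Type := {f : hom a b | R (Arr f)}.

Lemma sub_homP (a b : A) (f g : sub_hom a b) : sval f = sval g -> f = g.
Proof. by case: f g => [f p] [g q] /= e; subst g; rewrite (proof_irrelevance _ p q). Qed.

Lemma R_sub_comp (a b c : A) (f : sub_hom a b) (g : sub_hom b c) :
  R (Arr (sval g \o sval f)%perm).
Proof. by rewrite -acompE; apply: R_comp => //; [case: f | case: g]. Qed.

Program Definition sub_cat : category :=
  {| ob := A; hom := sub_hom; idm := fun a => exist _ (idm a) (R_id a);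
     comp := fun a b c g f => exist _ (sval g \o sval f)%perm (R_sub_comp f g) |}.
Next Obligation. by move=> a b f; apply: sub_homP; rewrite /= comp1m. Qed.
Next Obligation. by move=> a b f; apply: sub_homP; rewrite /= compm1. Qed.
Next Obligation. by move=> a b c d f g h; apply: sub_homP; rewrite /= compA. Qed.

Lemma sub_heq (a b c d : A) (f : @hom sub_cat a b) (g : @hom sub_cat c d) :
  heq (sval f) (sval g) -> heq f g.
Proof.
move=> e; have [e1 e2] := heq_ob e; subst c d.
by rewrite (sub_homP (heq_eq e)).
Qed.

Lemma sval_idto (a b : sub_cat) (e : a = b) :
  sval (idto e) = @idto A a b e.
Proof. by case: b / e. Qed.

Program Definition sub_perm : permcat :=
  {| pcat := sub_cat; padd := @padd A; pzero := @pzero A;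
     paddm := fun a b c d f g =>
       exist _ (sval f \+ sval g)%perm (R_add (proj2_sig f) (proj2_sig g));
     pbeta := fun a b => exist _ (pbeta a b) (R_bet a b) |}.
Next Obligation. by move=> *; apply: sub_homP; rewrite /= paddm1. Qed.
Next Obligation. by move=> *; apply: sub_homP; rewrite /= paddmM. Qed.
Next Obligation. by move=> *; apply: paddA. Qed.
Next Obligation. by move=> *; apply: padd0. Qed.
Next Obligation. by move=> *; apply: p0add. Qed.
Next Obligation. by move=> *; apply: sub_heq; apply: paddmA. Qed.
Next Obligation. by move=> *; apply: sub_heq; apply: paddm0. Qed.
Next Obligation. by move=> *; apply: sub_heq; apply: p0addm. Qed.
Next Obligation. by move=> *; apply: sub_homP; rewrite /= pbeta_nat. Qed.
Next Obligation. by move=> *; apply: sub_homP; rewrite /= pbetaK. Qed.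
Next Obligation.
move=> a b c; apply: sub_heq; apply/heqP; rewrite /= sval_idto.
by rewrite -!acompE arr_idto acompm1 /= ?paddA //; apply: bet_hex.
Qed.

Program Definition sub_incl_fun : functor sub_perm A :=
  {| fob := fun a => a; fmap := fun a b f => sval f |}.
Next Obligation. by []. Qed.
Next Obligation. by []. Qed.

Program Definition sub_incl_sm : smfunctor sub_perm A :=
  {| smf := sub_incl_fun; sm2 := fun a b => idm (a + b)%perm; sm0 := idm pzero |}.
Next Obligation. by move=> *; apply: is_iso1. Qed.
Next Obligation. by move=> *; apply: is_iso1. Qed.
Next Obligation. by move=> * /=; rewrite comp1m compm1. Qed.
Next Obligation. by move=> * /=; rewrite !comp1m !paddm1 paddA; apply: HEq. Qed.
Next Obligation. by move=> * /=; rewrite comp1m; apply: p0addm. Qed.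
Next Obligation. by move=> * /=; rewrite comp1m; apply: paddm0. Qed.
Next Obligation. by move=> * /=; rewrite comp1m compm1. Qed.

Lemma sub_incl_strict : is_strict sub_incl_sm.
Proof. by split=> *; apply: HEq. Qed.

Definition sub_incl : strictfunctor sub_perm A := StrictFunctor sub_incl_strict.

(** Invertibility in the subcategory requires the inverses to satisfy [R] too; the triangle
    identities are reflected by the faithful inclusion. *)
Lemma sub_invpair (d : invpair A) (ieta ieps : arr A) :
  ainv (Arr (pd_eta d)) ieta -> ainv (Arr (pd_eps d)) ieps ->
  R (Arr (pd_eta d)) -> R ieta -> R (Arr (pd_eps d)) -> R ieps ->
  exists d' : invpair sub_perm, maps_pair sub_incl d' d.
Proof.
case: ieta ieps => [a b ieta] [a' b' ieps] [/= e1 e2 eta1 eta2] [/= e3 e4 eps1 eps2].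
subst a b a' b' => Reta Rieta Reps Rieps.
pose d' : pairdata sub_perm := @PairData sub_perm (pd_l d) (pd_r d)
  (exist _ (pd_eta d) Reta) (exist _ (pd_eps d) Reps).
have m : maps_pair sub_incl d' d by split=> //; apply: HEq.
have [_ _ zl zr] := ipP d.
rewrite !acompE in eta1 eta2 eps1 eps2.
suff h : is_invertible_pair d' by exists (InvPair h).
split.
- exists (exist _ ieta Rieta : @hom sub_perm (pd_r d + pd_l d)%perm pzero).
  by split; apply: sub_homP; apply/heq_eq/heqP.
- exists (exist _ ieps Rieps : @hom sub_perm pzero (pd_l d + pd_r d)%perm).
  by split; apply: sub_homP; apply/heq_eq/heqP.
- apply: sub_homP; apply/heq_eq/heqP.
  by have := amap_zigl m; rewrite zl.
- apply: sub_homP; apply/heq_eq/heqP.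
  by have := amap_zigr m; rewrite zr.
Qed.

End SubPerm.

(** * Chaotic permutative categories on a monoid *)

(* One morphism between any two objects: strict functors to [chaotic] are additive
   maps of objects, so that the universal property of [P] controls its objects. *)
Section Chaotic.
Variables (M : Type) (op : M -> M -> M) (e : M).
Hypotheses (opA : associative op) (op1 : right_id e op) (op1l : left_id e op).

Program Definition chaotic_cat : category :=
  {| ob := M; hom := fun _ _ => unit; idm := fun=> tt; comp := fun _ _ _ _ _ => tt |}.
Next Obligation. by move=> ? ? []. Qed.
Next Obligation. by move=> ? ? []. Qed.
Next Obligation. by []. Qed.

Lemma chaotic_heq (a b c d : M) (f : @hom chaotic_cat a b) (g : @hom chaotic_cat c d) :
  a = c -> b = d -> heq f g.
Proof. by move=> e1 e2; subst c d; case: f g => [] []; apply: HEq. Qed.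

Program Definition chaotic : permcat :=
  {| pcat := chaotic_cat; padd := op; pzero := e; paddm := fun _ _ _ _ _ _ => tt;
     pbeta := fun _ _ => tt |}.
Next Obligation. by []. Qed.
Next Obligation. by []. Qed.
Next Obligation. exact: opA. Qed.
Next Obligation. exact: op1. Qed.
Next Obligation. exact: op1l. Qed.
Next Obligation. by move=> *; apply: chaotic_heq; apply: opA. Qed.
Next Obligation. by move=> *; apply: chaotic_heq; apply: op1. Qed.
Next Obligation. by move=> *; apply: chaotic_heq; apply: op1l. Qed.
Next Obligation. by []. Qed.
Next Obligation. by []. Qed.
Next Obligation. by move=> *; apply: chaotic_heq; rewrite /= ?opA. Qed.

Lemma chaotic_iso (a b : chaotic) (f : hom a b) : is_iso f.
Proof. by exists tt. Qed.

Lemma chaotic_eq (a b : chaotic) (f g : hom a b) : f = g.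
Proof. by case: f g => [] []. Qed.

Definition chaotic_pair (a b : chaotic) : invpair chaotic.
Proof.
refine (@InvPair chaotic (@PairData chaotic a b tt tt) _).
by split; (try exact: chaotic_iso); apply: chaotic_eq.
Defined.

Variables (A : permcat) (h : A -> M).
Hypotheses (hD : forall a b, h (a + b)%perm = op (h a) (h b)) (h0 : h pzero = e).

Program Definition chaotic_fun : functor A chaotic :=
  {| fob := h; fmap := fun _ _ _ => tt |}.
Next Obligation. by []. Qed.
Next Obligation. by []. Qed.

Program Definition chaotic_sm : smfunctor A chaotic :=
  {| smf := chaotic_fun; sm2 := fun _ _ => tt; sm0 := tt |}.
Next Obligation. by move=> *; apply: chaotic_iso. Qed.
Next Obligation. by move=> *; apply: chaotic_iso. Qed.
Next Obligation. by []. Qed.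
Next Obligation. by move=> *; apply: chaotic_heq; rewrite /= ?opA ?paddA. Qed.
Next Obligation. by move=> *; apply: chaotic_heq; rewrite /= ?op1l ?p0add. Qed.
Next Obligation. by move=> *; apply: chaotic_heq; rewrite /= ?op1 ?padd0. Qed.
Next Obligation. by []. Qed.

Lemma chaotic_strict : is_strict chaotic_sm.
Proof. by split=> *; apply: chaotic_heq; rewrite /= ?hD. Qed.

Definition chaotic_functor : strictfunctor A chaotic := StrictFunctor chaotic_strict.

End Chaotic.

Lemma smid_strict (A : permcat) : is_strict (smid A).
Proof. by split=> *; apply: HEq. Qed.

(** * Objects and parallel morphisms of the free category *)

Section FreeInvertible.
Variables (S : forall C, freeperm C) (P : free_invertible S).
Local Notation x := (pd_l (fi_gen P)).
Local Notation y := (pd_r (fi_gen P)).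

Definition gen_pair : invpair P := InvPair (fi_gen_invertible P).

(** [P] maps to the subcategory cut out by [R]; followed by the inclusion, this fixes the generating
    pair, so it is the identity and every morphism satisfies [R]. *)
Lemma free_invertible_ind (R : arr P -> Prop) :
  (forall a, R (aid a)) ->
  (forall f g, cod f = dom g -> R f -> R g -> R (g * f)) ->
  (forall f g, R f -> R g -> R (f + g)) ->
  (forall a b, R (bet a b)) ->
  (forall f g, ainv f g -> R f -> R g) ->
  R (Arr (pd_eta (fi_gen P))) -> R (Arr (pd_eps (fi_gen P))) ->
  forall f, R f.
Proof.
move=> R1 RM RD Rb RV Reta Reps f.
have [/is_iso_arr[ieta eta_inv] /is_iso_arr[ieps eps_inv] _ _] := ipP gen_pair.
have [d' m'] := sub_invpair R1 RM RD Rb eta_inv eps_inv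
  Reta (RV _ _ eta_inv Reta) Reps (RV _ _ eps_inv Reps).
have [F mF] := free_invertible_lift P d'.
have e := free_invertible_uniq (maps_pair_comp mF m')
  (G := StrictFunctor (smid_strict P)) (And4 erefl erefl (HEq _) (HEq _)) f.
have -> : f = Arr (sval (fmap F (mor f))) by case: f e => a b f /esym.
exact: (proj2_sig (fmap F (mor f))).
Qed.

Lemma exists_words : exists omega : P -> seq bool,
  [/\ forall p q, omega (p + q)%perm = omega p ++ omega q, omega pzero = [::],
      omega x = [:: true], omega y = [:: false]
    & forall p, word_ob gen_pair (omega p) = p].
Proof.
(* The word of an object is its image under the strict functor to the chaotic category on the free
   monoid. *)
pose W := chaotic (@catA bool) (@cats0 bool) (@cat0s bool).
have [F mF] := free_invertible_lift P
  (chaotic_pair ([:: true] : W) ([:: false] : W)).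
have [Fx Fy _ _] := mF.
have FD a b : F (a + b)%perm = F a ++ F b := strict_ob F a b.
have F0 : F pzero = [::] := strict0 F.
exists F; split=> // p.
(* On the monoid of objects of [P], the identity and the map reading an object as a word and
   evaluating it are both additive and agree on [x] and [y], hence coincide. *)
pose C := chaotic (@paddA P) (@padd0 P) (@p0add P).
pose Q1 := chaotic_functor (@paddA P) (@padd0 P) (@p0add P) (h := id)
  (fun a b => erefl) erefl.
have hD a b : word_ob gen_pair (F (a + b)%perm)
    = (word_ob gen_pair (F a) + word_ob gen_pair (F b))%perm.
  by rewrite FD word_ob_cat.
have h0 : word_ob gen_pair (F pzero) = pzero by rewrite F0.
pose Q2 := chaotic_functor (@paddA P) (@padd0 P) (@p0add P)
  (h := fun p => word_ob gen_pair (F p)) hD h0.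
have m1 : maps_pair Q1 (fi_gen P) (chaotic_pair (x : C) (y : C)).
  by split=> //; apply: chaotic_heq.
have wx : word_ob gen_pair (F x) = x by rewrite Fx /= padd0.
have wy : word_ob gen_pair (F y) = y by rewrite Fy /= padd0.
have m2 : maps_pair Q2 (fi_gen P) (chaotic_pair (x : C) (y : C)).
  by split=> //; apply: chaotic_heq; rewrite /= ?hD ?h0 ?wx ?wy.
exact: amap_ob p (free_invertible_uniq m2 m1).
Qed.

Lemma parallel_up_to_sign : exists t : hom (@pzero P) pzero,
  bet x x = Arr t + aid (x + x)%perm /\
  forall (p q : P) (f g : hom p q), f = g \/ Arr f = Arr t + Arr g.
Proof.
have [t [tK bxx]] := bet_self gen_pair; exists t; split=> // p q.
have [/is_iso_arr[[a b ieta] ieta_inv] _ _ _] := ipP gen_pair.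
have [/= e1 e2 _ _] := ieta_inv; subst a b.
have [w [wD w0 wx wy wK]] := exists_words.
(* Every morphism is stable between the words of its endpoints, by induction on morphisms. *)
have st f : @stable _ gen_pair t ieta (w (dom f)) (w (cod f)) f.
  elim/free_invertible_ind: f => [a|f g e sf sg|f g sf sg|a b|f g fg sf||] /=.
  - by rewrite -{3}(wK a); apply: stable_id.
  - by rewrite cod_comp dom_comp //; apply: stable_comp sf _; rewrite ?e.
  - by rewrite !wD; apply: stable_add.
  - have : @stable _ gen_pair t ieta (w a ++ w b) (w b ++ w a)
        (bet (word_ob gen_pair (w a)) (word_ob gen_pair (w b))) by apply: stable_bet.
    by rewrite !wK !wD.
  - by have [-> -> _ _] := fg; apply: stable_inv sf fg.
  - by rewrite wD w0 wx wy; apply: stable_eta.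
  - by rewrite wD w0 wx wy; apply: stable_eps.
move=> f g; have [s [] -> e] := stable_parallel tK ieta_inv (st (Arr f)) (st (Arr g));
  last by right.
by left; apply/heq_eq/heqP; rewrite e a0add.
Qed.

Lemma exists_word_arr (w v : seq bool) : (nx w + ny v = nx v + ny w)%N ->
  exists f : arr P, dom f = word_ob gen_pair w /\ cod f = word_ob gen_pair v.
Proof.
have [/is_iso_arr[[a b ieta] ieta_inv] _ _ _] := ipP gen_pair.
have [/= e1 e2 _ _] := ieta_inv; subst a b.
exact: hom_of_words ieta_inv w v.
Qed.
End FreeInvertible.

(** * Faithfulness and fullness of [K], and its quasi-inverse *)

Section Equivalence.
Import GRing.Theory.
Variables (S : forall C, freeperm C) (P : free_invertible S).
Variable K : strictfunctor P superint.
Hypothesis K_gen : maps_pair K (fi_gen P) super_one.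
Local Notation x := (pd_l (fi_gen P)).
Local Notation y := (pd_r (fi_gen P)).

Definition asign (f : arr superint) : int := sval (mor f).

(** An integer instead of a morphism of [superint], so that signs are compared without transport
    along endpoints. *)
Definition ksign (p q : P) (f : hom p q) : int := asign (amap K (Arr f)).

Lemma ksignE (p q : P) (f : hom p q) : is_sign (ksign f).
Proof. exact: super_sign. Qed.

Lemma ksign_id (p : P) : ksign (idm p) = 1%R.
Proof. by rewrite /ksign -[Arr _]/(aid p) amap_id. Qed.

Lemma ksign_comp (p q r : P) (f : hom p q) (g : hom q r) :
  ksign (g \o f)%perm = (ksign g * ksign f)%R.
Proof. by rewrite /ksign /amap /= fmapM. Qed.

Lemma ksign_add (p q p' q' : P) (f : hom p q) (g : hom p' q') :
  ksign (f \+ g)%perm = (ksign f * ksign g)%R.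
Proof. by rewrite /ksign -[Arr _]/(Arr f + Arr g) amap_add. Qed.

Lemma ksign_beta (p q : P) : ksign (pbeta p q) = ((-1) ^ ((K q : int) * (K p : int)))%R.
Proof. by rewrite /ksign -[Arr _]/(bet p q) amap_bet. Qed.

Lemma asign_sm2 (p q : P) : asign (Arr (sm2 K p q)) = 1%R.
Proof. by rewrite strict_sm2. Qed.

Lemma asign_sm0 : asign (Arr (sm0 K)) = 1%R.
Proof. by have [_ /heqP ->] := strictP K. Qed.

Lemma K_add (p q : P) : K (p + q)%perm = ((K p : int) + (K q : int))%R.
Proof. exact: strict_ob. Qed.

Lemma K_hom (p q : P) (f : hom p q) : K p = K q.
Proof. exact: super_eq (fmap K f). Qed.

(** Since [K x = 1], the symmetry of [x] with itself goes to the symmetry of [1] with itself, which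
    is -1. *)
Lemma ksign_sym (t : hom (@pzero P) pzero) :
  bet x x = Arr t + aid (x + x)%perm -> ksign t = (-1)%R.
Proof.
move=> bxx; have := ksign_beta x x; have [-> _ _ _] := K_gen.
rewrite /ksign -[Arr (pbeta _ _)]/(bet x x) bxx amap_add amap_id /asign /=.
by rewrite !mulr1 expr1z.
Qed.

(** Otherwise [f] is [t + g], whose sign is opposite to that of [g], and no sign is its own
    opposite. *)
Lemma K_faithful (p q : P) (f g : hom p q) : ksign f = ksign g -> f = g.
Proof.
have [t [bxx par]] := parallel_up_to_sign P; have kt := ksign_sym bxx.
have [//|e] := par p q f g.
have -> : ksign f = (- ksign g)%R.
  by rewrite /ksign e amap_add -[LHS]/(ksign t * ksign g)%R kt mulN1r.
by move: (ksignE g) => /orP[] /eqP ->.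
Qed.

Lemma K_faithful_heq (p q p' q' : P) (f : hom p q) (g : hom p' q') :
  p = p' -> q = q' -> ksign f = ksign g -> heq f g.
Proof. by move=> e1 e2; subst p' q' => /K_faithful ->; apply: HEq. Qed.

Lemma K_words (w : seq bool) :
  K (word_ob (gen_pair P) w) = ((nx w)%:Z - (ny w)%:Z)%R.
Proof.
have [kx ky _ _] := K_gen.
elim: w => [|b w IH]; first exact: strict0.
have -> : K (word_ob (gen_pair P) (b :: w))
    = ((K (if b then x else y) : int) + (K (word_ob (gen_pair P) w) : int))%R.
  exact: K_add.
by rewrite IH nx_cons ny_cons; case: b; rewrite ?kx ?ky /=; lia.
Qed.

(** Equal values of [K] mean equal differences between the counts of [x] and [y], hence some
    morphism exists; adding [t] corrects its sign if necessary. Choice makes the lift available as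
    data for the quasi-inverse. *)
Lemma K_full (p q : P) (s : int) : K p = K q -> is_sign s ->
  {f : hom p q | ksign f = s}.
Proof.
move=> e hs; apply: constructive_indefinite_description.
have [w [_ _ _ _ wK]] := exists_words P.
have [f ef] : exists f : hom p q, True.
  have [|[a b f] [/= ea eb]] := @exists_word_arr _ P (w p) (w q).
    have := K_words (w p); have := K_words (w q); rewrite !wK e => ->; lia.
  by rewrite !wK in ea eb; subst a b; exists f.
have [t [bxx _]] := parallel_up_to_sign P; have kt := ksign_sym bxx.
case: (eqVneq (ksign f) s) => [|ne]; first by exists f.
have [g eg] : exists g : hom p q, Arr g = Arr t + Arr f.
  have : dom (Arr t + Arr f) = p /\ cod (Arr t + Arr f) = q by rewrite /= !p0add.
  by case: (Arr t + Arr f) => a b g [/= e1 e2]; subst a b; exists g.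
exists g; rewrite /ksign eg amap_add -[LHS]/(ksign t * ksign f)%R kt.
by move: hs (ksignE f) ne => /orP[] /eqP -> /orP[] /eqP ->.
Qed.

Definition klift (p q : P) (s : int) (e : K p = K q) (hs : is_sign s) : hom p q :=
  sval (K_full e hs).

Lemma ksign_lift (p q : P) (s : int) (e : K p = K q) (hs : is_sign s) :
  ksign (klift e hs) = s.
Proof. exact: (proj2_sig (K_full e hs)). Qed.

(** The lift of the same sign in the opposite direction is an inverse, as signs square to 1 and [K]
    is faithful. *)
Lemma all_iso (p q : P) (f : hom p q) : is_iso f.
Proof.
have e := esym (K_hom f).
exists (klift e (ksignE f)).
by split; apply: K_faithful;
   rewrite ksign_comp ksign_lift ksign_id is_sign_sqr // ksignE.
Qed.

Definition int_ob (n : int) : P := word_ob (gen_pair P)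
  (if n is Posz k then nseq k true else nseq `|n|%N false).

Lemma K_int_ob (n : int) : K (int_ob n) = n.
Proof. by rewrite K_words /nx /ny; case: n => n; rewrite !count_nseq /=; lia. Qed.

Lemma int_ob_hom (k j : int) (f : super_hom k j) : K (int_ob k) = K (int_ob j).
Proof. by rewrite !K_int_ob; apply: super_eq f. Qed.

Program Definition kinv_fun : functor superint P :=
  {| fob := int_ob; fmap := fun k j f => klift (int_ob_hom f) (super_sign f) |}.
Next Obligation. by move=> k; apply: K_faithful; rewrite ksign_lift ksign_id. Qed.
Next Obligation.
by move=> k j l f g; apply: K_faithful; rewrite ksign_comp !ksign_lift.
Qed.

Lemma K_int_ob_add (k j : int) : K (int_ob k + int_ob j)%perm = K (int_ob (k + j)%R).
Proof. by rewrite K_add !K_int_ob. Qed.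

Lemma K_int_ob0 : K pzero = K (int_ob 0%R).
Proof. by rewrite K_int_ob. Qed.

(** The structure maps cannot be identities, since [int_ob] is not additive; they are the lifts of
    the sign 1. By faithfulness each axiom becomes an equation between signs. *)
Program Definition kinv : smfunctor superint P :=
  {| smf := kinv_fun; sm2 := fun k j => klift (K_int_ob_add k j) (s := 1%R) isT;
     sm0 := klift K_int_ob0 (s := 1%R) isT |}.
Next Obligation. by move=> *; apply: all_iso. Qed.
Next Obligation. exact: all_iso. Qed.
Next Obligation.
move=> k j k' j' f g; apply: K_faithful.
by rewrite !ksign_comp ksign_add !ksign_lift mulr1 mul1r.
Qed.
Next Obligation.
move=> k j l; apply: K_faithful_heq; rewrite /= ?paddA ?addrA //.
by rewrite !ksign_comp !ksign_add !ksign_lift !ksign_id.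
Qed.
Next Obligation.
move=> k; apply: K_faithful_heq; rewrite /= ?p0add ?add0r //.
by rewrite !ksign_comp !ksign_add !ksign_lift !ksign_id.
Qed.
Next Obligation.
move=> k; apply: K_faithful_heq; rewrite /= ?padd0 ?addr0 //.
by rewrite !ksign_comp !ksign_add !ksign_lift !ksign_id.
Qed.
Next Obligation.
move=> k j; apply: K_faithful.
by rewrite !ksign_comp !ksign_lift ksign_beta mulr1 mul1r !K_int_ob.
Qed.

Program Definition kinv_counit : montransf (smcomp kinv K) (smid P) :=
  {| mt := fun p => klift (K_int_ob (K p)) (s := 1%R) isT |}.
Next Obligation.
by move=> p q f; apply: K_faithful; rewrite !ksign_comp !ksign_lift mulr1 mul1r.
Qed.
Next Obligation.
move=> p q; apply: K_faithful; rewrite !ksign_comp ksign_add !ksign_lift ksign_id.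
by rewrite !mul1r mulr1; apply: asign_sm2.
Qed.
Next Obligation.
apply: K_faithful; rewrite /= !ksign_comp !ksign_lift ?ksign_id.
by rewrite ?mul1r ?mulr1; apply: asign_sm0.
Qed.

Program Definition kinv_unit : montransf (smcomp K kinv) (smid superint) :=
  {| mt := fun k => SuperHom (s := 1%R) isT (K_int_ob k) |}.
Next Obligation.
move=> k j f; apply: val_inj => /=.
rewrite mul1r mulr1. exact: (ksign_lift (int_ob_hom f) (super_sign f)).
Qed.
Next Obligation.
move=> k j; apply: val_inj => /=.
have e : sval (fmap K (klift (K_int_ob_add k j) (s := 1%R) isT)) = 1%R := ksign_lift _ _.
by rewrite e !mul1r; apply: asign_sm2.
Qed.
Next Obligation.
apply: val_inj => /=.
have e : sval (fmap K (klift K_int_ob0 (s := 1%R) isT)) = 1%R := ksign_lift _ _.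
by rewrite e !mul1r; apply: asign_sm0.
Qed.

Lemma K_equivalence : sm_equivalence K.
Proof.
exists kinv; split.
  by exists kinv_counit => p; apply: all_iso.
exists kinv_unit => k.
exists (SuperHom (s := 1%R) isT (esym (K_int_ob k))).
by split; apply: val_inj.
Qed.

End Equivalence.

Theorem theorem7p34 (S : forall C : category, freeperm C)
    (P : free_invertible S) (K : strictfunctor P superint) :
  maps_pair K (fi_gen P) super_one -> sm_equivalence K.
Proof. exact: K_equivalence. Qed.
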